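(* Let $d\in\{2,3\}$, $\Omega$, $\boldsymbol U_N$, $\boldsymbol W_N$ be as in the context, let $\nu,\eta,\mu,\rho,\tau>0$ and $k\in\{1,2\}$. Let $n\ge k-1$ and suppose $\boldsymbol u^{n+1-j}\in\boldsymbol U_N$, $\boldsymbol B^{n+1-j}\in\boldsymbol W_N$ for $j=1,\dots,k$, and that $(\boldsymbol u^{n+1},\boldsymbol B^{n+1})\in\boldsymbol U_N\times\boldsymbol W_N$ satisfies, for all $(\boldsymbol\chi,\boldsymbol\Phi)\in\boldsymbol U_N\times\boldsymbol W_N$, $$\tfrac1\tau(\gamma\boldsymbol u^{n+1}-\hat{\boldsymbol u},\boldsymbol\chi)+(\tilde{\boldsymbol u}^{n+1}\cdot\nabla\boldsymbol u^{n+1},\boldsymbol\chi)+\nu(\nabla\boldsymbol u^{n+1},\nabla\boldsymbol\chi)=\tfrac{1}{\mu\rho}\big((\nabla\times\boldsymbol B^{n+1})\times\tilde{\boldsymbol B}^{n+1},\boldsymbol\chi\big)+(\boldsymbol f^{n+1},\boldsymbol\chi),$$ $$\tfrac1\tau(\gamma\boldsymbol B^{n+1}-\hat{\boldsymbol B},\boldsymbol\Phi)+\eta(\nabla\times\boldsymbol B^{n+1},\nabla\times\boldsymbol\Phi)-\big(\nabla\times(\boldsymbol u^{n+1}\times\tilde{\boldsymbol B}^{n+1}),\boldsymbol\Phi\big)=0,$$ with $\boldsymbol f^{n+1}=\boldsymbol 0$. Then $$\mathcal E^{n+1}-\mathcal E^n=-\mathcal D^{n+1}-\nu\|\nabla\boldsymbol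 u^{n+1}\|^2-\frac{\eta}{\mu\rho}\|\nabla\times\boldsymbol B^{n+1}\|^2,$$ where for $k=1$: $\mathcal E^n=\frac1{2\tau}\big(\|\boldsymbol u^n\|^2+\frac1{\mu\rho}\|\boldsymbol B^n\|^2\big)$, $\mathcal D^{n+1}=\frac1{2\tau}\big(\|\boldsymbol u^{n+1}-\boldsymbol u^n\|^2+\frac1{\mu\rho}\|\boldsymbol B^{n+1}-\boldsymbol B^n\|^2\big)$; and for $k=2$: $\mathcal E^n=\frac1{4\tau}\big(\|\boldsymbol u^n\|^2+\|2\boldsymbol u^n-\boldsymbol u^{n-1}\|^2+\frac1{\mu\rho}\|\boldsymbol B^n\|^2+\frac1{\mu\rho}\|2\boldsymbol B^n-\boldsymbol B^{n-1}\|^2\big)$, $\mathcal D^{n+1}=\frac1{4\tau}\big(\|\boldsymbol u^{n+1}-2\boldsymbol u^n+\boldsymbol u^{n-1}\|^2+\frac1{\mu\rho}\|\boldsymbol B^{n+1}-2\boldsymbol B^n+\boldsymbol B^{n-1}\|^2\big)$.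
   Context: $\|\cdot\|$ and $(\cdot,\cdot)$ are the $L^2(\Omega)$ norm and inner product. For $k=1$: $\gamma=1$, $\hat\chi=\chi^n$, $\tilde\chi^{n+1}=\chi^n$; for $k=2$: $\gamma=3/2$, $\hat\chi=2\chi^n-\frac12\chi^{n-1}$, $\tilde\chi^{n+1}=2\chi^n-\chi^{n-1}$ (applied to $\boldsymbol u$ and $\boldsymbol B$). $\Lambda=(-1,1)$, $\Omega=\mathcal F(\Lambda^d)$ with $\mathcal F$ a diffeomorphism of $[-1,1]^d$ onto $\overline\Omega$; $\mathcal F^{\rm div}[\boldsymbol\Phi](\boldsymbol x)=\frac{\partial_{\boldsymbol\xi}\boldsymbol x}{\det\partial_{\boldsymbol\xi}\boldsymbol x}\boldsymbol\Phi(\mathcal F^{-1}(\boldsymbol x))$ (Jacobian of $\mathcal F$). One-dimensional functions: $L_n$ Legendre; $P_n^{(-1,-1)}(\xi)=\frac{\xi^2-1}{4}P_{n-2}^{(1,1)}(\xi)$ ($n\ge2$), $P_n^{(-2,-2)}(\xi)=(\frac{\xi^2-1}{4})^2P_{n-4}^{(2,2)}(\xi)$ ($n\ge4$), $P^{(\alpha,\beta)}$ classical Jacobi; $\psi_m=\frac{\sqrt{2(2m-1)}}{m-1}P_m^{(-1,-1)}$, $\phi_n=\sqrt{\frac{2n+1}{2}}L_n$, $\varphi_m=\frac{\sqrt{8(2m-3)}}{(m-3)(m-2)}P_m^{(-2,-2)}$. Spaces ($N\ge4$): for $d=2$, $\boldsymbol W_N=\mathrm{span}\{\mathcal F^{\rm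 div}[(\psi_{m+1}(\xi_1)\phi_n(\xi_2),-\phi_m(\xi_1)\psi_{n+1}(\xi_2))^\intercal]\}_{m,n=1}^{N-1}$ and $\boldsymbol U_N=\mathrm{span}\{\mathcal F^{\rm div}[(\varphi_{m+3}(\xi_1)\psi_{n+2}(\xi_2),-\psi_{m+2}(\xi_1)\varphi_{n+3}(\xi_2))^\intercal]\}_{m,n=1}^{N-3}$. For $d=3$, $\boldsymbol W_N$ is the span over $m,n,l=1,\dots,N-1$ of the Piola images of $(\psi_{m+1}\phi_n\phi_l,-\phi_m\psi_{n+1}\phi_l,0)$, $(\psi_{m+1}\phi_n\phi_l,0,-\phi_m\phi_n\psi_{l+1})$, $(0,\psi_{n+1}(\xi_2)\phi_l(\xi_3),-\phi_n(\xi_2)\psi_{l+1}(\xi_3))$, $(\psi_{m+1}(\xi_1)\phi_l(\xi_3),0,-\phi_m(\xi_1)\psi_{l+1}(\xi_3))$, $(\psi_{m+1}(\xi_1)\phi_n(\xi_2),-\phi_m(\xi_1)\psi_{n+1}(\xi_2),0)$ (in triple products the factors are functions of $\xi_1,\xi_2,\xi_3$ in order); $\boldsymbol U_N$ is the span over $m,n,l=1,\dots,N-3$ of the Piola images of $(\varphi_{m+3}\psi_{n+2}\psi_{l+2},-\psi_{m+2}\varphi_{n+3}\psi_{l+2},0)$, $(\varphi_{m+3}\psi_{n+2}\psi_{l+2},0,-\psi_{m+2}\psi_{n+2}\varphi_{l+3})$, $(0,\psi_2\varphi_{n+3}\psi_{l+2},-\psi_2\psi_{n+2}\varphi_{l+3})$,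 $(\varphi_{m+3}\psi_2\psi_{l+2},0,-\psi_{m+2}\psi_2\varphi_{l+3})$, $(\varphi_{m+3}\psi_{n+2}\psi_2,-\psi_{m+2}\varphi_{n+3}\psi_2,0)$. In 2D, for vectors $\boldsymbol a,\boldsymbol b$ and scalar $c$: $\nabla\times\boldsymbol v=\partial_1v_2-\partial_2v_1$, $\nabla\times c=(\partial_2c,-\partial_1c)^\intercal$, $\boldsymbol a\times\boldsymbol b=a_1b_2-a_2b_1$, $c\times\boldsymbol b=(-cb_2,cb_1)^\intercal$. *)

(* Defs.v *)
From mathcomp Require Import all_boot all_order all_algebra.
From mathcomp Require Import all_classical all_reals all_analysis.
Set Implicit Arguments. Unset Strict Implicit. Unset Printing Implicit Defensive.
Import Order.TTheory GRing.Theory Num.Theory.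
Local Open Scope ring_scope.
Local Open Scope classical_set_scope.

Definition fld (R : realType) (d : nat) := 'rV[R]_d -> 'rV[R]_d.

Definition cmp {R : realType} {d : nat} (v : fld R d) (i : 'I_d) : 'rV[R]_d -> R :=
  fun x => v x ord0 i.

Definition pd {R : realType} {d : nat} (j : 'I_d) (g : 'rV[R]_d -> R)
  (x : 'rV[R]_d) : R := 'D_(delta_mx 0 j) g x.

Definition dotv {R : realType} {d : nat} (a b : 'rV[R]_d) : R :=
  \sum_(i < d) a ord0 i * b ord0 i.

Definition row2 {R : realType} (a b : R) : 'rV[R]_2 :=
  \row_(i < 2) nth 0 [:: a; b] i.
Definition row3 {R : realType} (a b c : R) : 'rV[R]_3 :=
  \row_(i < 3) nth 0 [:: a; b; c] i.

(* coordinate indices (0-based: x_1 is index 0) *)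
Definition i2 (k : nat) : 'I_2 := inord k.
Definition i3 (k : nat) : 'I_3 := inord k.

Definition volint2 {R : realType} (D : set 'rV[R]_2) (g : 'rV[R]_2 -> R) : R :=
  Rintegral (@lebesgue_measure R \x @lebesgue_measure R)%E
    [set p | D (row2 p.1 p.2)] (fun p => g (row2 p.1 p.2)).

Definition volint3 {R : realType} (D : set 'rV[R]_3) (g : 'rV[R]_3 -> R) : R :=
  Rintegral ((@lebesgue_measure R \x @lebesgue_measure R) \x @lebesgue_measure R)%E
    [set p | D (row3 p.1.1 p.1.2 p.2)] (fun p => g (row3 p.1.1 p.1.2 p.2)).

Definition volint {R : realType} (d : nat) :
  set 'rV[R]_d -> ('rV[R]_d -> R) -> R :=
  match d return set 'rV[R]_d -> ('rV[R]_d -> R) -> R with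
  | 2 => @volint2 R
  | 3 => @volint3 R
  | _ => fun _ _ => 0
  end.

Definition ip {R : realType} {d : nat} (Om : set 'rV[R]_d) (f g : fld R d) : R :=
  volint Om (fun x => dotv (f x) (g x)).

Definition ipgrad {R : realType} {d : nat} (Om : set 'rV[R]_d) (f g : fld R d) : R :=
  volint Om (fun x => \sum_(i < d) \sum_(j < d) pd j (cmp f i) x * pd j (cmp g i) x).

Definition convect {R : realType} {d : nat} (w v : fld R d) : fld R d :=
  fun x => \row_(i < d) \sum_(j < d) w x ord0 j * pd j (cmp v i) x.

Definition curl2 {R : realType} (v : fld R 2) (x : 'rV[R]_2) : R :=
  pd (i2 0) (cmp v (i2 1)) x - pd (i2 1) (cmp v (i2 0)) x.

Definition scurl2 {R : realType} (c : 'rV[R]_2 -> R) : fld R 2 :=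
  fun x => row2 (pd (i2 1) c x) (- pd (i2 0) c x).

Definition cross2 {R : realType} (a b : 'rV[R]_2) : R :=
  a ord0 (i2 0) * b ord0 (i2 1) - a ord0 (i2 1) * b ord0 (i2 0).

Definition scross2 {R : realType} (c : R) (b : 'rV[R]_2) : 'rV[R]_2 :=
  row2 (- (c * b ord0 (i2 1))) (c * b ord0 (i2 0)).

Definition lorentz2 {R : realType} (B Bt : fld R 2) : fld R 2 :=
  fun x => scross2 (curl2 B x) (Bt x).
Definition curldot2 {R : realType} (B P : fld R 2) (x : 'rV[R]_2) : R :=
  curl2 B x * curl2 P x.
Definition induct2 {R : realType} (u Bt : fld R 2) : fld R 2 :=
  scurl2 (fun y => cross2 (u y) (Bt y)).

Definition curl3 {R : realType} (v : fld R 3) : fld R 3 :=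
  fun x => row3
    (pd (i3 1) (cmp v (i3 2)) x - pd (i3 2) (cmp v (i3 1)) x)
    (pd (i3 2) (cmp v (i3 0)) x - pd (i3 0) (cmp v (i3 2)) x)
    (pd (i3 0) (cmp v (i3 1)) x - pd (i3 1) (cmp v (i3 0)) x).

Definition cross3 {R : realType} (a b : 'rV[R]_3) : 'rV[R]_3 :=
  row3 (a ord0 (i3 1) * b ord0 (i3 2) - a ord0 (i3 2) * b ord0 (i3 1))
       (a ord0 (i3 2) * b ord0 (i3 0) - a ord0 (i3 0) * b ord0 (i3 2))
       (a ord0 (i3 0) * b ord0 (i3 1) - a ord0 (i3 1) * b ord0 (i3 0)).

Definition lorentz3 {R : realType} (B Bt : fld R 3) : fld R 3 :=
  fun x => cross3 (curl3 B x) (Bt x).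
Definition curldot3 {R : realType} (B P : fld R 3) (x : 'rV[R]_3) : R :=
  dotv (curl3 B x) (curl3 P x).
Definition induct3 {R : realType} (u Bt : fld R 3) : fld R 3 :=
  curl3 (fun y => cross3 (u y) (Bt y)).

Definition lorentz {R : realType} (d : nat) : fld R d -> fld R d -> fld R d :=
  match d return fld R d -> fld R d -> fld R d with
  | 2 => @lorentz2 R | 3 => @lorentz3 R | _ => fun _ _ _ => 0 end.
Definition curldot {R : realType} (d : nat) : fld R d -> fld R d -> 'rV[R]_d -> R :=
  match d return fld R d -> fld R d -> 'rV[R]_d -> R with
  | 2 => @curldot2 R | 3 => @curldot3 R | _ => fun _ _ _ => 0 end.
Definition induct {R : realType} (d : nat) : fld R d -> fld R d -> fld R d :=
  match d return fld R d -> fld R d -> fld R d with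
  | 2 => @induct2 R | 3 => @induct3 R | _ => fun _ _ _ => 0 end.

Definition jacobi {R : realType} (a b n : nat) (x : R) : R :=
  \sum_(s < n.+1) ('C(n + a, n - s))%:R * ('C(n + b, s))%:R
     * ((x - 1) / 2) ^+ s * ((x + 1) / 2) ^+ (n - s).

Definition legendre {R : realType} (n : nat) (x : R) : R := jacobi 0 0 n x.

(* generalized Jacobi P_n^{(-1,-1)} (n >= 2), P_n^{(-2,-2)} (n >= 4) *)
Definition jacm1 {R : realType} (n : nat) (x : R) : R :=
  (x ^+ 2 - 1) / 4 * jacobi 1 1 (n - 2) x.
Definition jacm2 {R : realType} (n : nat) (x : R) : R :=
  ((x ^+ 2 - 1) / 4) ^+ 2 * jacobi 2 2 (n - 4) x.

Definition psi {R : realType} (m : nat) (x : R) : R :=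
  Num.sqrt (2 * (2 * m%:R - 1)) / (m%:R - 1) * jacm1 m x.
Definition phi {R : realType} (n : nat) (x : R) : R :=
  Num.sqrt ((2 * n%:R + 1) / 2) * legendre n x.
Definition vphi {R : realType} (m : nat) (x : R) : R :=
  Num.sqrt (8 * (2 * m%:R - 3)) / ((m%:R - 3) * (m%:R - 2)) * jacm2 m x.

Definition wref2 {R : realType} (m n : nat) : fld R 2 := fun xi =>
  let x1 := xi ord0 (i2 0) in let x2 := xi ord0 (i2 1) in
  row2 (psi m.+1 x1 * phi n x2) (- (phi m x1 * psi n.+1 x2)).

Definition uref2 {R : realType} (m n : nat) : fld R 2 := fun xi =>
  let x1 := xi ord0 (i2 0) in let x2 := xi ord0 (i2 1) in
  row2 (vphi (m + 3) x1 * psi (n + 2) x2)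
       (- (psi (m + 2) x1 * vphi (n + 3) x2)).

Definition wref3 {R : realType} (t m n l : nat) : fld R 3 := fun xi =>
  let x1 := xi ord0 (i3 0) in let x2 := xi ord0 (i3 1) in
  let x3 := xi ord0 (i3 2) in
  match t with
  | 0 => row3 (psi m.+1 x1 * phi n x2 * phi l x3)
              (- (phi m x1 * psi n.+1 x2 * phi l x3)) 0
  | 1 => row3 (psi m.+1 x1 * phi n x2 * phi l x3) 0
              (- (phi m x1 * phi n x2 * psi l.+1 x3))
  | 2 => row3 0 (psi n.+1 x2 * phi l x3) (- (phi n x2 * psi l.+1 x3))
  | 3 => row3 (psi m.+1 x1 * phi l x3) 0 (- (phi m x1 * psi l.+1 x3))
  | _ => row3 (psi m.+1 x1 * phi n x2) (- (phi m x1 * psi n.+1 x2)) 0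
  end.

Definition uref3 {R : realType} (t m n l : nat) : fld R 3 := fun xi =>
  let x1 := xi ord0 (i3 0) in let x2 := xi ord0 (i3 1) in
  let x3 := xi ord0 (i3 2) in
  match t with
  | 0 => row3 (vphi (m + 3) x1 * psi (n + 2) x2 * psi (l + 2) x3)
              (- (psi (m + 2) x1 * vphi (n + 3) x2 * psi (l + 2) x3)) 0
  | 1 => row3 (vphi (m + 3) x1 * psi (n + 2) x2 * psi (l + 2) x3) 0
              (- (psi (m + 2) x1 * psi (n + 2) x2 * vphi (l + 3) x3))
  | 2 => row3 0 (psi 2 x1 * vphi (n + 3) x2 * psi (l + 2) x3)
              (- (psi 2 x1 * psi (n + 2) x2 * vphi (l + 3) x3))
  | 3 => row3 (vphi (m + 3) x1 * psi 2 x2 * psi (l + 2) x3) 0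
              (- (psi (m + 2) x1 * psi 2 x2 * vphi (l + 3) x3))
  | _ => row3 (vphi (m + 3) x1 * psi (n + 2) x2 * psi 2 x3)
              (- (psi (m + 2) x1 * vphi (n + 3) x2 * psi 2 x3)) 0
  end.

Definition refW2 {R : realType} (N : nat) (P : fld R 2) : Prop :=
  exists c : nat -> nat -> R, forall xi,
    P xi = \sum_(1 <= m < N) \sum_(1 <= n < N) c m n *: wref2 m n xi.
Definition refU2 {R : realType} (N : nat) (P : fld R 2) : Prop :=
  exists c : nat -> nat -> R, forall xi,
    P xi = \sum_(1 <= m < N - 2) \sum_(1 <= n < N - 2) c m n *: uref2 m n xi.
Definition refW3 {R : realType} (N : nat) (P : fld R 3) : Prop :=
  exists c : nat -> nat -> nat -> nat -> R, forall xi,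
    P xi = \sum_(t < 5) \sum_(1 <= m < N) \sum_(1 <= n < N) \sum_(1 <= l < N)
             c t m n l *: wref3 t m n l xi.
Definition refU3 {R : realType} (N : nat) (P : fld R 3) : Prop :=
  exists c : nat -> nat -> nat -> nat -> R, forall xi,
    P xi = \sum_(t < 5) \sum_(1 <= m < N - 2) \sum_(1 <= n < N - 2)
             \sum_(1 <= l < N - 2) c t m n l *: uref3 t m n l xi.

Definition refW {R : realType} (d N : nat) : fld R d -> Prop :=
  match d return fld R d -> Prop with
  | 2 => @refW2 R N | 3 => @refW3 R N | _ => fun _ => False end.
Definition refU {R : realType} (d N : nat) : fld R d -> Prop :=
  match d return fld R d -> Prop with
  | 2 => @refU2 R N | 3 => @refU3 R N | _ => fun _ => False end.

Definition cube_open {R : realType} {d : nat} (xi : 'rV[R]_d) : Prop :=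
  forall i, -1 < xi ord0 i < 1.
Definition cube_cl {R : realType} {d : nat} (xi : 'rV[R]_d) : Prop :=
  forall i, -1 <= xi ord0 i <= 1.

Definition jac {R : realType} {d : nat} (F : fld R d) (xi : 'rV[R]_d) : 'M[R]_d :=
  \matrix_(i < d, j < d) pd j (cmp F i) xi.

Fixpoint Ck {R : realType} {V W : normedModType R} (k : nat) (f : V -> W) : Prop :=
  match k with
  | 0 => continuous f
  | k'.+1 => (forall x, differentiable f x) /\ forall v : V, Ck k' (fun x => 'd f x v)
  end.
Definition smooth {R : realType} {V W : normedModType R} (f : V -> W) : Prop :=
  forall k, Ck k f.

(* F is a diffeomorphism of [-1,1]^d onto its image: smooth (extended
   to all of R^d), injective on [-1,1]^d, with invertible Jacobian there *)
Definition diffeo_cube {R : realType} {d : nat} (F : fld R d) : Prop :=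
  [/\ smooth F,
      (forall xi eta, cube_cl xi -> cube_cl eta -> F xi = F eta -> xi = eta) &
      (forall xi, cube_cl xi -> \det (jac F xi) != 0)].

Definition Omega {R : realType} {d : nat} (F : fld R d) : set 'rV[R]_d :=
  F @` [set xi | cube_open xi].

(* v is (on closure Omega) the contravariant Piola image of some Phi in S:
   v(F xi) = (J(xi) / det J(xi)) Phi(xi) *)
Definition piola_of {R : realType} {d : nat} (F : fld R d) (S : fld R d -> Prop)
  (v : fld R d) : Prop :=
  exists2 P, S P & forall xi, cube_cl xi ->
    v (F xi) = (\det (jac F xi))^-1 *: (P xi *m (jac F xi)^T).

Definition UN {R : realType} {d : nat} (N : nat) (F : fld R d) : fld R d -> Prop :=
  piola_of F (@refU R d N).
Definition WN {R : realType} {d : nat} (N : nat) (F : fld R d) : fld R d -> Prop :=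
  piola_of F (@refW R d N).

Definition gam {R : realType} (k : nat) : R := if k == 2 then 3 / 2 else 1.
Definition hatf {R : realType} {d : nat} (k : nat) (c : nat -> fld R d) (n : nat) : fld R d :=
  if k == 2 then fun x => 2 *: c n x - (1 / 2) *: c n.-1 x else c n.
Definition tldf {R : realType} {d : nat} (k : nat) (c : nat -> fld R d) (n : nat) : fld R d :=
  if k == 2 then fun x => 2 *: c n x - c n.-1 x else c n.

Definition sqn {R : realType} {d : nat} (Om : set 'rV[R]_d) (v : fld R d) : R := ip Om v v.

Definition energy {R : realType} {d : nat} (k : nat) (Om : set 'rV[R]_d)
  (mu rho tau : R) (u B : nat -> fld R d) (n : nat) : R :=
  if k == 2 then
    (4 * tau)^-1 * (sqn Om (u n) + sqn Om (fun x => 2 *: u n x - u n.-1 x)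
       + (mu * rho)^-1 * sqn Om (B n)
       + (mu * rho)^-1 * sqn Om (fun x => 2 *: B n x - B n.-1 x))
  else (2 * tau)^-1 * (sqn Om (u n) + (mu * rho)^-1 * sqn Om (B n)).

(* D^{n+1}, given n *)
Definition dissip {R : realType} {d : nat} (k : nat) (Om : set 'rV[R]_d)
  (mu rho tau : R) (u B : nat -> fld R d) (n : nat) : R :=
  if k == 2 then
    (4 * tau)^-1 * (sqn Om (fun x => u n.+1 x - 2 *: u n x + u n.-1 x)
       + (mu * rho)^-1 * sqn Om (fun x => B n.+1 x - 2 *: B n x + B n.-1 x))
  else (2 * tau)^-1 * (sqn Om (fun x => u n.+1 x - u n x)
       + (mu * rho)^-1 * sqn Om (fun x => B n.+1 x - B n x)).

(* Main.v *)
(* Test the momentum equation with [u^{n+1}] and the induction equation with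
   [B^{n+1}].  The convective term vanishes because the extrapolated velocity is
   divergence free and the velocity vanishes on the boundary; the Lorentz and induction
   terms cancel after an integration by parts whose boundary term carries the
   velocity; the time differences are polarisation identities.

   The reference velocity fields are divergence free because
   [P_n^{(-2,-2)}' = (n-3)/2 P_{n-1}^{(-1,-1)}], and the Piola transform preserves this
   by Jacobi's formula and the symmetry of the second derivatives of [F].

   No change of variables is used on the curved domain [Omega]: if [g] is C^1 on the
   open set [Omega] with bounded gradient and zero boundary values, each line meets
   [Omega] in a countable union of intervals at whose end points [g] tends to [0], so
   the integral of a partial derivative of [g] over [Omega] vanishes by Fubini and the
   fundamental theorem of calculus. *)
Require Import Defs.
From HB Require Import structures.
From mathcomp Require Import all_boot all_order all_algebra.
From mathcomp Require Import all_classical all_reals all_analysis.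
From mathcomp Require Import measurable_realfun perm ring lra zify.
Set Implicit Arguments. Unset Strict Implicit. Unset Printing Implicit Defensive.
Import Order.TTheory GRing.Theory Num.Theory.
Import numFieldNormedType.Exports.
Local Open Scope ring_scope.
Local Open Scope classical_set_scope.

(** * Jacobi polynomials *)

Section JacobiPolynomials.
Variable R : realType.
Implicit Types (x : R) (a b n k m : nat).

(** Membership in [UN] or [WN] prescribes a field only on the image of the closed cube, by a formula
    in reference coordinates; outside that image the field is arbitrary, whereas [pd] looks at a
    full neighbourhood of a point. Every derivative on [Omega F] therefore rests on two facts about
    the image: it is open, and the inverse of [F] is continuous and differentiable on it. Both are
    derived from compactness of the closed cube, injectivity, and invertibility of the Jacobian.
    Regularity up to the boundary is likewise never expressed on the physical domain: it is carried
    by a function of the reference variable that is continuous at every point of the closed cube, or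
    C^1 on an open set containing the cube. Compactness turns this into the bounds behind
    integrability and into the decay of velocity terms towards points outside [Omega F]. The
    normalising constants of the bases make the derivative of each [vphi] exactly a [psi], so each
    reference velocity is a planar curl times a function of the remaining variable. The tested
    induction equation enters with weight [(mu * rho)^-1], the weight that balances the Lorentz
    force. *)

Definition xm1half : {poly R} := 2^-1 *: ('X - 1%:P).
Definition xp1half : {poly R} := 2^-1 *: ('X + 1%:P).
Local Notation X := xm1half.
Local Notation Y := xp1half.

(** A homogeneous form in [X] and [Y]. Their product is the factor (x^2 - 1)/4 of the generalized
    polynomials, and both have derivative 1/2, so differentiation only shifts exponents. *)
Definition jacobip a b n : {poly R} :=
  \sum_(s < n.+1) ('C(n + a, n - s) * 'C(n + b, s))%:R *: (X ^+ s * Y ^+ (n - s)).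

Lemma jacobipE a b n : jacobi a b n = horner (jacobip a b n).
Proof.
apply/funext => x; rewrite /jacobi /jacobip horner_sum; apply: eq_bigr => s _.
rewrite hornerZ hornerM !horner_exp !hornerZ !hornerD ?hornerN ?hornerX ?hornerC.
by rewrite natrM !mulrA ![2^-1 * _]mulrC.
Qed.

Let quarter x : X.[x] * Y.[x] = (x ^+ 2 - 1) / 4.
Proof. by rewrite !hornerZ !hornerD !hornerN !hornerX !hornerC; field. Qed.

Lemma jacm1E n : jacm1 n = horner (X * Y * jacobip 1 1 (n - 2)).
Proof. by apply/funext => x; rewrite /jacm1 jacobipE !hornerM quarter. Qed.

Lemma jacm2E n : jacm2 n = horner ((X * Y) ^+ 2 * jacobip 2 2 (n - 4)).
Proof. by apply/funext => x; rewrite /jacm2 jacobipE hornerM horner_exp hornerM quarter. Qed.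

Let derivXY i j : deriv (X ^+ i.+1 * Y ^+ j.+1) =
  2^-1 *: ((X ^+ i * Y ^+ j.+1) *+ i.+1 + (X ^+ i.+1 * Y ^+ j) *+ j.+1).
Proof.
have dX : deriv X = 2^-1%:P.
  by rewrite derivZ derivB derivX derivC subr0 alg_polyC.
have dY : deriv Y = 2^-1%:P.
  by rewrite derivZ derivD derivX derivC addr0 alg_polyC.
rewrite derivM !deriv_exp dX dY /= !mul_polyC mulrnAl mulrnAr -scalerAl -scalerAr.
by rewrite !scalerMnr -scalerDr.
Qed.

(* The two halves of the product rule recombine through
   [(s + 1) C(n, s + 1) = (n - s) C(n, s)]. *)
Lemma deriv_jacobip22 k : deriv ((X * Y) ^+ 2 * jacobip 2 2 k) =
  (k.+1%:R / 2) *: (X * Y * jacobip 1 1 k.+1).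
Proof.
have -> : (X * Y) ^+ 2 * jacobip 2 2 k = \sum_(s < k.+1)
    ('C(k.+2, s.+2) * 'C(k.+2, s))%:R *: (X ^+ s.+2 * Y ^+ (k - s).+2).
  rewrite /jacobip mulr_sumr; apply: eq_bigr => s _.
  have ks : (s <= k)%N by rewrite -ltnS.
  rewrite addn2 -[in 'C(_, k - s)]bin_sub; last by lia.
  have -> : (k.+2 - (k - s) = s.+2)%N by lia.
  rewrite -scalerAr; congr (_ *: _); rewrite !exprS; ring.
rewrite raddf_sum /=.
have -> : X * Y * jacobip 1 1 k.+1 = \sum_(s < k.+2)
    ('C(k.+2, s.+1) * 'C(k.+2, s))%:R *: (X ^+ s.+1 * Y ^+ (k.+2 - s)).
  rewrite /jacobip mulr_sumr; apply: eq_bigr => s _.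
  have ks : (s <= k.+1)%N by rewrite -ltnS.
  rewrite addn1 -[in 'C(_, k.+1 - s)]bin_sub; last by lia.
  have -> : (k.+2 - (k.+1 - s) = s.+1)%N by lia.
  rewrite -scalerAr (subSn ks); congr (_ *: _); rewrite !exprS; ring.
pose M s := X ^+ s.+1 * Y ^+ (k.+2 - s).
have split_coef s : (s <= k.+1)%N -> (k.+1 * ('C(k.+2, s.+1) * 'C(k.+2, s)) =
    s.+2 * 'C(k.+2, s.+2) * 'C(k.+2, s) + s * 'C(k.+2, s.+1) * 'C(k.+2, s))%N.
  move=> sk; rewrite mul_bin_left -!mulnA -mulnDl; congr (_ * _)%N.
  by lia.
have -> : (k.+1%:R / 2) *: (\sum_(s < k.+2)
    ('C(k.+2, s.+1) * 'C(k.+2, s))%:R *: M s) =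
  2^-1 *: (\sum_(s < k.+2) (s.+2 * 'C(k.+2, s.+2) * 'C(k.+2, s))%:R *: M s +
   \sum_(s < k.+2) (s * 'C(k.+2, s.+1) * 'C(k.+2, s))%:R *: M s).
  rewrite mulrC -scalerA -big_split /= scaler_sumr; congr (_ *: _).
  apply: eq_bigr => s _.
  by rewrite scalerA -scalerDl -natrM -natrD split_coef// -ltnS.
(* The last term of the first sum vanishes because its binomial coefficient is out of range, the
   initial term of the second because of its factor [s]. Dropping them leaves two sums over the same
   index range. *)
rewrite [X in _ *: (X + _)]big_ord_recr [X in _ *: (_ + X)]big_ord_recl /=.
rewrite [in X in _ + X + _]bin_small// muln0 mul0n scale0r addr0.
rewrite 2!mul0n scale0r add0r.
rewrite -big_split /= scaler_sumr; apply: eq_bigr => s _.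
have ks : (s <= k)%N by rewrite -ltnS.
rewrite derivZ derivXY scalerA mulrC -scalerA; congr (_ *: _).
rewrite scalerDr -[X in _ *: X + _]scaler_nat -[X in _ + _ *: X]scaler_nat !scalerA -!natrM /M /bump /= add1n.
rewrite (subSn (leqW ks)) subSS (subSn ks).
congr (_ *: _ + _ *: _); apply: (congr1 (fun n => n%:R)).
  by rewrite mulnC mulnA.
have := mul_bin_left k.+2 s; rewrite (subSn (leqW ks)) (subSn ks).
by move=> H; rewrite -[RHS]mulnA [X in _ = (s.+1 * X)%N]mulnC mulnA H; lia.
Qed.

Lemma psiP m : exists p : {poly R}, psi m = horner p.
Proof.
exists ((Num.sqrt (2 * (2 * m%:R - 1)) / (m%:R - 1)) *: (X * Y * jacobip 1 1 (m - 2))).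
by apply/funext => x; rewrite /psi jacm1E hornerZ.
Qed.

Lemma phiP n : exists p : {poly R}, phi n = horner p.
Proof.
exists ((Num.sqrt ((2 * n%:R + 1) / 2)) *: jacobip 0 0 n).
by apply/funext => x; rewrite /phi /legendre jacobipE hornerZ.
Qed.

Lemma vphiP m : exists p : {poly R}, vphi m = horner p.
Proof.
exists ((Num.sqrt (8 * (2 * m%:R - 3)) / ((m%:R - 3) * (m%:R - 2))) *:
  ((X * Y) ^+ 2 * jacobip 2 2 (m - 4))).
by apply/funext => x; rewrite /vphi jacm2E hornerZ.
Qed.

(** The constants match: the factor m/2 from [deriv_jacobip22] cancels the factor m of the
    denominator m(m+1), and the radicand of [vphi] is four times that of [psi], which absorbs the
    remaining 1/2. *)
Lemma vphi_deriv (m : nat) x : (0 < m)%N ->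
  is_derive x 1 (vphi (m + 3)) (psi (m + 2) x).
Proof.
move=> m0; rewrite -(prednK m0); move: m.-1 => {m0} m.
have -> : vphi (m.+1 + 3) = horner ((Num.sqrt (8 * (2 * (m.+1 + 3)%:R - 3)) /
    (((m.+1 + 3)%:R - 3) * ((m.+1 + 3)%:R - 2))) *:
    ((X * Y) ^+ 2 * jacobip 2 2 m)) :> (R -> R).
  apply/funext => y; rewrite /vphi jacm2E hornerZ.
  by have -> : (m.+1 + 3 - 4 = m)%N by lia.
apply: DeriveDef; first exact: derivable_horner.
rewrite -derive1E -derivE derivZ deriv_jacobip22 !hornerZ.
rewrite /psi jacm1E; have -> : (m.+1 + 2 - 2 = m.+1)%N by lia.
rewrite mulrA; congr (_ * _).
have -> : 8 * (2 * (m.+1 + 3)%:R - 3) = 2 ^+ 2 * (2 * (2 * (m.+1 + 2)%:R - 1)) :> R.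
  by rewrite !natrD; ring.
rewrite sqrtrM ?sqr_ge0// sqrtr_sqr ger0_norm ?ler0n//.
rewrite !natrD; field.
by rewrite ?pnatr_eq0 /=; apply/andP; split; apply/lt0r_neq0; have := ler0n R m; lra.
Qed.

Lemma psi_pm1 m (e : R) : e ^+ 2 = 1 -> psi m e = 0.
Proof. by move=> e1; rewrite /psi /jacm1 e1 subrr !mul0r mulr0. Qed.

Lemma vphi_pm1 m (e : R) : e ^+ 2 = 1 -> vphi m e = 0.
Proof. by move=> e1; rewrite /vphi /jacm2 e1 subrr mul0r expr2 !mul0r mulr0. Qed.

End JacobiPolynomials.

(** * Symmetry of second derivatives *)

Section LineDerivative.
Variables (R : realType) (V W : normedModType R).

Lemma derive_lineE (f : V -> W) (x v : V) :
  'D_v f x = 'D_1 (fun h : R => f (h *: v + x)) 0.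
Proof.
rewrite /derive; set g1 := fun h => h^-1 *: _; set g2 := fun h => h^-1 *: _.
suff -> : g1 = g2 by [].
rewrite funeqE /g1 /g2 => h /=; rewrite addr0 scale0r add0r.
by congr (h^-1 *: (f (_ *: v + x) - f x)); exact/esym/mulr1.
Qed.

Lemma is_derive_line (f : V -> W) (x v : V) (df : W) :
  is_derive (0 : R) 1 (fun h : R => f (h *: v + x)) df -> is_derive x v f df.
Proof.
by case=> dx ex; apply: DeriveDef; [exact/derivable1P | rewrite derive_lineE].
Qed.

End LineDerivative.

Section LineSchwarz.
Variables (R : realType) (V : normedModType R).

Lemma derivable_line (W : normedModType R) (f : V -> W) (x v : V) (t : R) :
  derivable f (t *: v + x) v ->
  is_derive t 1 (fun h : R => f (h *: v + x)) ('D_v f (t *: v + x)).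
Proof.
move=> df; apply: is_derive_line.
rewrite [X in is_derive _ _ X _](_ : _ = (fun h : R => f (h *: v + (t *: v + x)))).
  by apply: DeriveDef; [exact: (derivable1P _ _ _).1 | rewrite -derive_lineE].
apply/funext => h; rewrite addrA -scalerDl; congr (f ((_ + _) *: v + x)).
exact: mulr1.
Qed.


Lemma mvt_line (f : V -> R) (x v : V) (s : R) :
  0 < s -> (forall t, 0 <= t <= s -> derivable f (t *: v + x) v) ->
  exists2 t, 0 < t < s & f (s *: v + x) - f x = s * 'D_v f (t *: v + x).
Proof.
move=> s0 df.
have [|t||c] := @MVT R (fun h => f (h *: v + x)) (fun t => 'D_v f (t *: v + x)) 0 s.
- exact: s0.
- rewrite in_itv /= => /andP[t0 ts]; apply: derivable_line; apply: df.
  by rewrite !ltW.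
- apply: derivable_within_continuous => t; rewrite in_itv /= => t0s.
  by have [] := derivable_line (df _ t0s).
- rewrite in_itv /= => t0s; rewrite scale0r add0r subr0 mulrC => ->.
  by exists c.
Qed.

Lemma schwarz (f : V -> R) (x v w : V) :
  (forall y, differentiable f y) ->
  (forall y, differentiable (fun z => 'D_v f z) y) ->
  (forall y, differentiable (fun z => 'D_w f z) y) ->
  {for x, continuous (fun z => 'D_w (fun z => 'D_v f z) z)} ->
  {for x, continuous (fun z => 'D_v (fun z => 'D_w f z) z)} ->
  'D_w (fun z => 'D_v f z) x = 'D_v (fun z => 'D_w f z) x.
Proof.
move=> df dv dw cvw cwv.
(* Both iterated derivatives are values, near [x], of the second difference
   of [f] over a small parallelogram divided by its area. *)
have second a b (s : R) : (forall y, differentiable (fun z => 'D_a f z) y) -> 0 < s ->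
    exists t, [/\ 0 < t.1 < s, 0 < t.2 < s &
    f (s *: b + (s *: a + x)) - f (s *: a + x) - (f (s *: b + x) - f x) =
    s * (s * 'D_b (fun z => 'D_a f z) (t.2 *: b + (t.1 *: a + x)))].
  move=> da s0.
  have D y : derivable (fun z => f (s *: b + z)) y a /\
      'D_a (fun z => f (s *: b + z)) y = 'D_a f (s *: b + y).
    suff [? ?] : is_derive y a (fun z => f (s *: b + z)) ('D_a f (s *: b + y)) by [].
    apply: is_derive_line.
    rewrite [X in is_derive _ _ X _](_ : _ = (fun h : R => f (h *: a + (s *: b + y)))).
      apply: DeriveDef; last by rewrite -derive_lineE.
      exact/(derivable1P _ _ _).1/diff_derivable.
    by apply/funext => h; rewrite addrCA.
  have [y|t1 t1s E1] := @mvt_line (fun z => f (s *: b + z) - f z) x a s s0.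
    by move=> _; apply: derivableB; [exact: (D _).1 | exact: diff_derivable].
  have [y|t2 t2s E2] := @mvt_line (fun z => 'D_a f z) (t1 *: a + x) b s s0.
    by move=> _; exact: diff_derivable.
  exists (t1, t2); split => //=; rewrite -E2.
  rewrite -(D _).2 -deriveB; [|exact: (D _).1|exact: diff_derivable].
  rewrite -E1; ring.
apply/eqP; rewrite -subr_eq0 -normr_le0; apply/ler_addgt0Pl => e e0; rewrite addr0.
have e20 : 0 < e / 2 by rewrite divr_gt0.
have near_close (g : V -> R) (a b : V) : {for x, continuous g} ->
    exists2 r : R, 0 < r & forall t1 t2 : R, 0 < t1 < r -> 0 < t2 < r ->
    `|g x - g (t2 *: b + (t1 *: a + x))| < e / 2.
  move=> cg.
  have /nbhs_ballP[r /= r0 gr] : \forall z \near x, `|g x - g z| < e / 2.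
    by move/cvgrPdist_lt : cg => /(_ _ e20).
  (* The offset t1 a + t2 b has norm below r as soon as t1 and t2 are below r / m; the summand 1
     keeps [m] positive when both directions are zero. *)
  pose m := 1 + `|a| + `|b|.
  have m0 : 0 < m by rewrite /m -addrA ltr_pwDl// addr_ge0.
  exists (r / m); first by rewrite divr_gt0.
  move=> t1 t2 /andP[t10 t1r] /andP[t20 t2r]; apply: gr.
  rewrite -ball_normE /= addrA opprD addrCA subrr addr0 normrN.
  have rm : r = r / m * m by rewrite divfK ?gt_eqF.
  apply: le_lt_trans (ler_normD _ _) _; rewrite !normrZ !gtr0_norm// rm.
  have am : t1 * `|a| <= r / m * `|a| by rewrite ler_wpM2r// ltW.
  have bm : t2 * `|b| <= r / m * `|b| by rewrite ler_wpM2r// ltW.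
  have rm0 : 0 < r / m by rewrite divr_gt0.
  have -> : r / m * m = r / m + r / m * `|a| + r / m * `|b|.
    by rewrite {2}/m !mulrDr mulr1.
  by move: am bm rm0;
    move: (r / m * `|a|) (r / m * `|b|) (t1 * `|a|) (t2 * `|b|) (r / m) => *; lra.
have [r1 r10 H1] := near_close _ v w cvw.
have [r2 r20 H2] := near_close _ w v cwv.
pose s := Num.min r1 r2 / 2.
have m0 : 0 < Num.min r1 r2 by rewrite lt_min r10.
have s0 : 0 < s by rewrite divr_gt0.
have [sr1 sr2] : s < r1 /\ s < r2.
  have : s < Num.min r1 r2 by rewrite /s; lra.
  by rewrite lt_min => /andP[].
have [t [/andP[t10 t1s] /andP[t20 t2s] Et]] := second v w s dv s0.
have [q [/andP[q10 q1s] /andP[q20 q2s] Eq]] := second w v s dw s0.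
have := H1 t.1 t.2; rewrite t10 t20 (lt_trans t1s)// (lt_trans t2s)// => /(_ isT isT).
have := H2 q.1 q.2; rewrite q10 q20 (lt_trans q1s)// (lt_trans q2s)// => /(_ isT isT).
move: Et Eq; rewrite [s *: w + (s *: v + x)]addrCA.
move: ('D_w _ (_ + _)) ('D_v _ (_ + _)) => A B.
move: (f _) (f _) (f _) (f _) => p1 p2 p3 p4 Et Eq h2 h1.
(* The second difference is symmetric in the two directions, so the two intermediate values agree
   once s^2 is cancelled. *)
have AB : B = A.
  by apply: (mulfI (lt0r_neq0 s0)); apply: (mulfI (lt0r_neq0 s0)); rewrite -Et -Eq; ring.
rewrite AB in h2.
move: h1 h2; set D1 := 'D_w _ x; set D2 := 'D_v _ x; move: D1 D2 => D1 D2 h1 h2.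
apply: le_trans (ler_distD A D1 D2) _; rewrite [leRHS]splitr lerD//; first exact: ltW.
by rewrite distrC ltW.
Qed.

End LineSchwarz.

(** * Partial derivatives *)

Section PartialDerivatives.
Variables (R : realType) (d : nat).
Implicit Types (f g : 'rV[R]_d -> R) (x : 'rV[R]_d) (D : set 'rV[R]_d) (i j : 'I_d).

Lemma pdE f x j : differentiable f x -> pd j f x = 'd f x (delta_mx 0 j).
Proof. by move=> df; rewrite /pd deriveE. Qed.

Lemma near_pd f g x j : (\near x, f x = g x) -> pd j f x = pd j g x.
Proof. exact: near_eq_derive. Qed.

Lemma pd_cst c x j : pd j (fun=> c : R) x = 0.
Proof. exact: derive_cst. Qed.

Lemma derivable_pdD f g x j :
  derivable f x (delta_mx 0 j) -> derivable g x (delta_mx 0 j) ->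
  pd j (fun x => f x + g x) x = pd j f x + pd j g x.
Proof. exact: deriveD. Qed.

Lemma derivable_pdM f g x j :
  derivable f x (delta_mx 0 j) -> derivable g x (delta_mx 0 j) ->
  pd j (fun x => f x * g x) x = f x * pd j g x + g x * pd j f x.
Proof. by move=> df dg; rewrite /pd (deriveM df dg). Qed.

Lemma pdD f g x j : differentiable f x -> differentiable g x ->
  pd j (fun x => f x + g x) x = pd j f x + pd j g x.
Proof. by move=> df dg; apply: derivable_pdD; apply: diff_derivable. Qed.

Lemma pdM f g x j : differentiable f x -> differentiable g x ->
  pd j (fun x => f x * g x) x = f x * pd j g x + g x * pd j f x.
Proof. by move=> df dg; apply: derivable_pdM; apply: diff_derivable. Qed.

Lemma pdV f x j : differentiable f x -> f x != 0 ->
  pd j (fun x => (f x)^-1) x = - (f x) ^- 2 * pd j f x.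
Proof. by move=> df f0; rewrite /pd (deriveV f0)//; exact: diff_derivable. Qed.

Lemma continuous_near_eq (f g : 'rV[R]_d -> R) x : (\forall y \near x, f y = g y) ->
  {for x, continuous g} -> {for x, continuous f}.
Proof.
move=> fg cg; have fgx := nbhs_singleton fg; rewrite /= in fgx.
rewrite /prop_for /continuous_at fgx.
apply: cvg_trans cg; apply: (@near_eq_cvg _ _ (nbhs x)).
by apply: filterS fg => y ->.
Qed.

Definition C1on D f := forall x, D x ->
  differentiable f x /\ forall j, {for x, continuous (pd j f)}.

Lemma C1on_subset D D' f : D' `<=` D -> C1on D f -> C1on D' f.
Proof. by move=> DD H x /DD /H. Qed.

Lemma C1on_continuous D f x : C1on D f -> D x -> {for x, continuous f}.
Proof. by move=> H /H[df _]; exact: differentiable_continuous. Qed.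

Lemma C1on_near D f x : open D -> C1on D f -> D x -> \forall y \near x, differentiable f y.
Proof.
move=> oD H Dx; have : nbhs x D by exact: open_nbhs_nbhs.
by apply: filterS => y /H[].
Qed.

Lemma C1on_cst D c : C1on D (fun=> c).
Proof.
move=> x _; split; first exact: differentiable_cst.
move=> j; have -> : pd j (fun=> c : R) = cst 0 by apply/funext => y; exact: pd_cst.
exact: cst_continuous.
Qed.

Lemma eq_C1on D f g : f =1 g -> C1on D f -> C1on D g.
Proof. by move=> /funext ->. Qed.

Lemma rV_ballP (x y : 'rV[R]_d) (r : R) : 0 < r ->
  ball x r y <-> forall i, `|x ord0 i - y ord0 i| < r.
Proof.
move=> r0; rewrite mx_norm_ball /ball_ /= /Num.Def.normr /= mx_normrE; split.
  by move=> /bigmax_ltP[_ H] i; have := H (ord0, i) isT; rewrite /= !mxE.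
move=> H; apply/bigmax_ltP; split; first exact: r0.
by move=> -[i j] _ /=; rewrite !mxE (ord1 i); exact: H.
Qed.

Section OpenDomain.
Variable D : set 'rV[R]_d.
Hypothesis oD : open D.

Lemma C1onD f g : C1on D f -> C1on D g -> C1on D (fun x => f x + g x).
Proof.
move=> Hf Hg x Dx; have [df cf] := Hf x Dx; have [dg cg] := Hg x Dx.
split; first exact: differentiableD.
move=> j; apply: (@continuous_near_eq _ (fun y => pd j f y + pd j g y)).
  apply: (filterS2 _ _ (C1on_near oD Hf Dx) (C1on_near oD Hg Dx)) => y.
  exact: pdD.
by apply: continuousD; [exact: cf | exact: cg].
Qed.

Lemma C1onM f g : C1on D f -> C1on D g -> C1on D (fun x => f x * g x).
Proof.
move=> Hf Hg x Dx; have [df cf] := Hf x Dx; have [dg cg] := Hg x Dx.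
split; first exact: differentiableM.
move=> j; apply: (@continuous_near_eq _ (fun y => f y * pd j g y + g y * pd j f y)).
  apply: (filterS2 _ _ (C1on_near oD Hf Dx) (C1on_near oD Hg Dx)) => y.
  exact: pdM.
have kf := differentiable_continuous df; have kg := differentiable_continuous dg.
by apply: continuousD; apply: continuousM; [exact: kf|exact: (cg j)|exact: kg|exact: (cf j)].
Qed.

Lemma C1onN f : C1on D f -> C1on D (fun x => - f x).
Proof.
move=> Hf; have := C1onM (C1on_cst (D := D) (-1)) Hf.
by congr (C1on D); apply/funext => x; rewrite mulN1r.
Qed.

Lemma C1onV f : (forall x, D x -> f x != 0) -> C1on D f -> C1on D (fun x => (f x)^-1).
Proof.
move=> f0 Hf x Dx; have [df cf] := Hf x Dx.
split; first exact: differentiableV (f0 x Dx).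
move=> j; apply: (@continuous_near_eq _ (fun y => - (f y * f y)^-1 * pd j f y)).
  have : nbhs x D by exact: open_nbhs_nbhs.
  apply: filterS => y Dy; rewrite -expr2; apply: pdV; last exact: f0.
  by have [] := Hf y Dy.
have kf := differentiable_continuous df.
apply: continuousM; last exact: (cf j).
apply: continuousN; apply: continuousV; first by rewrite mulf_neq0// f0.
by apply: continuousM; exact: kf.
Qed.

Lemma C1on_sum (I : Type) (r : seq I) (P : pred I) (f : I -> 'rV[R]_d -> R) :
  (forall a, P a -> C1on D (f a)) -> C1on D (fun x => \sum_(a <- r | P a) f a x).
Proof.
move=> H; elim: r => [|a r IH].
  by have := C1on_cst (D := D) 0; congr (C1on D); apply/funext => x; rewrite big_nil.
case Pa: (P a).
  have := C1onD (H a Pa) IH; congr (C1on D); apply/funext => x; by rewrite big_cons Pa.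
by move: IH; congr (C1on D); apply/funext => x; rewrite big_cons Pa.
Qed.

Lemma C1on_prod (I : Type) (r : seq I) (P : pred I) (f : I -> 'rV[R]_d -> R) :
  (forall a, P a -> C1on D (f a)) -> C1on D (fun x => \prod_(a <- r | P a) f a x).
Proof.
move=> H; elim: r => [|a r IH].
  by have := C1on_cst (D := D) 1; congr (C1on D); apply/funext => x; rewrite big_nil.
case Pa: (P a).
  have := C1onM (H a Pa) IH; congr (C1on D); apply/funext => x; by rewrite big_cons Pa.
by move: IH; congr (C1on D); apply/funext => x; rewrite big_cons Pa.
Qed.

Lemma pd_sum (I : Type) (r : seq I) (P : pred I) (f : I -> 'rV[R]_d -> R) x j :
  D x -> (forall a, P a -> C1on D (f a)) ->
  pd j (fun x => \sum_(a <- r | P a) f a x) x = \sum_(a <- r | P a) pd j (f a) x.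
Proof.
move=> Dx H; elim: r => [|a r IH].
  rewrite big_nil (_ : (fun _ => _) = cst 0) ?pd_cst//.
  by apply/funext => y; rewrite big_nil.
rewrite big_cons; case Pa: (P a).
  have d1 := (H a Pa x Dx).1; have d2 := (C1on_sum r H Dx).1.
  rewrite -IH -(pdD j d1 d2).
  by congr (pd j _ x); apply/funext => y; rewrite big_cons Pa.
by rewrite -IH; congr (pd j _ x); apply/funext => y; rewrite big_cons Pa.
Qed.

End OpenDomain.

Lemma diff_horner_coord (p : {poly R}) i x :
  differentiable (fun x : 'rV[R]_d => p.[x ord0 i]) x /\
  forall j, pd j (fun x : 'rV[R]_d => p.[x ord0 i]) x = (i == j)%:R * (deriv p).[x ord0 i].
Proof.
have dc : differentiable (fun x : 'rV[R]_d => x ord0 i) x by exact: differentiable_coord.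
have pc j : pd j (fun x : 'rV[R]_d => x ord0 i) x = (i == j)%:R.
  rewrite /pd derive_lineE.
  rewrite [X in derive X](_ : _ = (fun h : R => h * (i == j)%:R + x ord0 i)); last first.
    by apply/funext => h; rewrite !mxE eqxx.
  rewrite derive_val.
  by rewrite /GRing.scale /= ?mulr0 ?mulr1 ?addr0 ?add0r.
elim/poly_ind: p => [|p c [dp Ep]].
  have E : (fun x : 'rV[R]_d => (0 : {poly R}).[x ord0 i]) = cst 0.
    by apply/funext => y; rewrite horner0.
  by rewrite E; split; [exact: differentiable_cst | move=> j; rewrite pd_cst deriv0 horner0 mulr0].
have E : (fun x : 'rV[R]_d => (p * 'X + c%:P).[x ord0 i]) =
    (fun x : 'rV[R]_d => p.[x ord0 i] * x ord0 i + c).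
  by apply/funext => y; rewrite !hornerE.
rewrite E; have dpx := differentiableM dp dc; split.
  exact: (differentiableD dpx (differentiable_cst c x)).
move=> j; rewrite (pdD j dpx (differentiable_cst c x)).
rewrite pd_cst addr0 pdM// pc Ep derivD derivC addr0 derivM derivX mulr1.
by rewrite hornerD hornerM hornerX; ring.
Qed.

Lemma C1on_horner_coord (p : {poly R}) i : C1on setT (fun x => p.[x ord0 i]).
Proof.
move=> x _; split; first by have [] := diff_horner_coord p i x.
move=> j; have -> : pd j (fun x : 'rV[R]_d => p.[x ord0 i]) =
    (fun x => (i == j)%:R * (deriv p).[x ord0 i]).
  by apply/funext => y; have [] := diff_horner_coord p i y.
apply: continuousM; first exact: cst_continuous.
apply: continuous_comp; last exact: continuous_horner.
exact: coord_continuous.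
Qed.

End PartialDerivatives.

(** * Diffeomorphisms of the cube *)

Section SmoothMaps.
Variables (R : realType) (d : nat).
Implicit Types (F : fld R d) (i j k : 'I_d).

Lemma smooth_differentiable F x : smooth F -> differentiable F x.
Proof. by move=> /(_ 1%N) [dF _]. Qed.

Lemma smooth_diff F v : smooth F -> smooth (fun x => 'd F x v).
Proof. by move=> sF k; have [_ /(_ v)] := sF k.+1. Qed.

Lemma differentiable_cmp F i x : differentiable F x -> differentiable (cmp F i) x.
Proof.
move=> dF; apply: (@differentiable_comp _ _ _ _ F (fun y : 'rV[R]_d => y ord0 i)) => //.
exact: differentiable_coord.
Qed.

Lemma pd_cmp F i j x : differentiable F x -> pd j (cmp F i) x = cmp (fun y => 'd F y (delta_mx 0 j)) i x.
Proof.
move=> dF; rewrite /cmp /= -deriveE// derive_mx; last exact: diff_derivable.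
by rewrite mxE.
Qed.

Lemma pd_smooth F i j : smooth F ->
  pd j (cmp F i) = cmp (fun y => 'd F y (delta_mx 0 j)) i.
Proof.
by move=> sF; apply/funext => x; apply: pd_cmp; exact: smooth_differentiable.
Qed.

Lemma C1on_smooth F i : smooth F -> C1on setT (cmp F i).
Proof.
move=> sF x _; split; first exact/differentiable_cmp/smooth_differentiable.
move=> j; rewrite pd_smooth//; apply: differentiable_continuous.
exact/differentiable_cmp/smooth_differentiable/smooth_diff.
Qed.

Lemma C1on_jac F i j : smooth F -> C1on setT (fun x => jac F x i j).
Proof.
move=> sF; have := C1on_smooth i (smooth_diff (delta_mx 0 j) sF).
by congr C1on; apply/funext => x; rewrite mxE pd_smooth.
Qed.

Lemma C1on_det F : smooth F -> C1on setT (fun x => \det (jac F x)).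
Proof.
move=> sF; apply: C1on_sum; first exact: openT.
move=> s _; apply: C1onM; [exact: openT | exact: C1on_cst |].
apply: C1on_prod; first exact: openT.
by move=> i _; exact: C1on_jac.
Qed.

Lemma pd_jac_sym F i j k x : smooth F ->
  pd k (fun y => jac F y i j) x = pd j (fun y => jac F y i k) x.
Proof.
move=> sF.
have E l : (fun y => jac F y i l) = (fun y => 'D_(delta_mx 0 l) (cmp F i) y).
  by apply/funext => y; rewrite mxE.
have dD l y : differentiable (fun z => 'D_(delta_mx 0 l) (cmp F i) z) y.
  by rewrite -E; have [] := C1on_jac i l sF (x := y) I.
have cD l m y : {for y, continuous (fun w =>
    'D_(delta_mx 0 m) (fun z => 'D_(delta_mx 0 l) (cmp F i) z) w)}.
  by rewrite -E; exact: (C1on_jac i l sF (x := y) I).2.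
rewrite !E; apply: schwarz => //.
by move=> y; exact/differentiable_cmp/smooth_differentiable.
Qed.

(** For a diffeomorphism this is an open set containing the closed cube, so C^1 up to the boundary
    can be stated as C^1 on an open set where the Piola factor 1/det is harmless. *)
Definition regular F : set 'rV[R]_d := [set x | \det (jac F x) != 0].

Lemma open_regular F : smooth F -> open (regular F).
Proof.
move=> sF.
rewrite (_ : regular F = (fun x => \det (jac F x)) @^-1` (~` [set 0])); last first.
  by apply/seteqP; split => x /= /eqP.
apply: open_comp; last exact/closed_openC/closed_eq.
by move=> x _; exact: C1on_continuous (C1on_det sF) _.
Qed.

End SmoothMaps.

Section Cube.
Variables (R : realType) (d : nat).
Local Notation cl := [set xi : 'rV[R]_d | cube_cl xi].
Local Notation op := [set xi : 'rV[R]_d | cube_open xi].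

Lemma cube_compact : compact cl.
Proof.
rewrite (_ : cl = [set v : 'rV[R]_d | forall i, `[-1, 1]%classic (v ord0 i)]).
  have H := @rV_compact R d (fun=> `[-1, 1]%classic) (fun=> @segment_compact R (-1) 1).
  exact: H.
by apply/seteqP; split => v /= H i; have := H i; rewrite /= in_itv.
Qed.

Lemma cube_open_cl (xi : 'rV[R]_d) : cube_open xi -> cube_cl xi.
Proof. by move=> H i; have /andP[? ?] := H i; rewrite !ltW. Qed.

Lemma open_cube : open op.
Proof.
rewrite openE => x ox.
have H (i : 'I_d) : nbhs x [set y : 'rV[R]_d | -1 < y ord0 i < 1].
  apply: open_nbhs_nbhs; split; last exact: ox.
  rewrite (_ : [set _ | _] = (fun xi : 'rV[R]_d => xi ord0 i) @^-1` `]-1, 1[%classic).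
    apply: open_comp; last exact: interval_open.
    by move=> y _; exact: coord_continuous.
  by apply/seteqP; split => v /=; rewrite in_itv.
have K := @filter_forall _ _ (fun i (y : 'rV[R]_d) => is_true (-1 < y ord0 i < 1))
  (nbhs x) (nbhs_filter x) H.
by apply: filterS K => y Hy i; exact: Hy.
Qed.

End Cube.

(** * Continuity of the inverse and openness of the image *)

Section InverseMap.
Variables (R : realType) (d : nat) (F : fld R d).
Hypothesis dF : diffeo_cube F.
Local Notation cl := [set xi : 'rV[R]_d | cube_cl xi].

Let sF : smooth F. Proof. by case: dF. Qed.

Lemma diffeo_inj xi eta : cube_cl xi -> cube_cl eta -> F xi = F eta -> xi = eta.
Proof. by case: dF => _ H _; exact: H. Qed.

Lemma diffeo_regular xi : cube_cl xi -> regular F xi.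
Proof. by case: dF => _ _; apply. Qed.

Lemma diffeo_continuous : continuous F.
Proof. by move=> x; exact/differentiable_continuous/smooth_differentiable. Qed.

(* Continuity of the inverse of [F] on the compact cube, at an arbitrary point
   of the target space (the fibre over [y] may be empty). *)
Lemma fibre_near (y : 'rV[R]_d) (U : set 'rV[R]_d) : open U ->
  (forall xi, cube_cl xi -> F xi = y -> U xi) ->
  \forall x \near y, forall xi, cube_cl xi -> F xi = x -> U xi.
Proof.
move=> oU yU.
(* The points with a preimage in the cube outside [U] form the image of a compact set, hence a
   closed set, and it misses [y]. *)
have cK : compact (F @` (cl `&` ~` U)).
  apply: continuous_compact; first exact/continuous_subspaceT/diffeo_continuous.
  by apply: compact_closedI; [exact: cube_compact | exact: open_closedC].
have clK : closed (F @` (cl `&` ~` U)).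
  by apply: compact_closed => //; exact: norm_hausdorff.
have : nbhs y (~` (F @` (cl `&` ~` U))).
  apply: open_nbhs_nbhs; split; first exact: closed_openC.
  by move=> [xi [cxi nU] Fxi]; exact: nU (yU _ cxi Fxi).
apply: filterS => x nx xi cxi Fx; apply: contrapT => nU; apply: nx.
by exists xi.
Qed.

Lemma continuous_attains_min (f : 'rV[R]_d -> R) : continuous f ->
  exists2 c, cube_cl c & forall xi, cube_cl xi -> f c <= f xi.
Proof.
move=> cf; have cl0 : cl !=set0 by exists 0 => i /=; rewrite mxE lerN10 ler01.
have [c cc H] := EVT_min_rV cl0 (@cube_compact R d) (continuous_subspaceT cf).
exists c; first by move: cc; rewrite inE.
by move=> xi cxi; apply: H; rewrite inE.
Qed.

(** The norm of row vectors is the sup norm, which is not differentiable; the Euclidean square is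
    smooth and its critical points are governed by the Jacobian. *)
Let sqdist (y z : 'rV[R]_d) := \sum_i (z ord0 i - y ord0 i) * (z ord0 i - y ord0 i).

Let continuous_sqdist y : continuous (sqdist y).
Proof.
move=> z; apply: (C1on_continuous (D := setT)) => //.
apply: C1on_sum; first exact: openT.
move=> i _; have C : C1on setT (fun x0 : 'rV[R]_d => x0 ord0 i - y ord0 i).
  apply: C1onD; [exact: openT | | exact: C1on_cst].
  by apply: eq_C1on (C1on_horner_coord 'X i) => w; rewrite hornerX.
by apply: eq_C1on (C1onM openT C C).
Qed.

Let C1on_term (y : 'rV[R]_d) i :
  C1on setT (fun z => (cmp F i z - y ord0 i) * (cmp F i z - y ord0 i)).
Proof.
have C : C1on setT (fun z => cmp F i z - y ord0 i).
  by apply: C1onD; [exact: openT | exact: C1on_smooth | exact: C1on_cst].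
by apply: eq_C1on (C1onM openT C C).
Qed.

Let C1on_sqdist y : C1on setT (fun z => sqdist y (F z)).
Proof.
apply: C1on_sum; first exact: openT.
by move=> i _; exact: eq_C1on (C1on_term y i).
Qed.

Let pd_sqdist (y : 'rV[R]_d) k z : pd k (fun z => sqdist y (F z)) z =
  2 * \sum_i (F z ord0 i - y ord0 i) * jac F z i k.
Proof.
have -> : (fun z => sqdist y (F z)) =
    (fun z => \sum_i (cmp F i z - y ord0 i) * (cmp F i z - y ord0 i)) by [].
rewrite (@pd_sum _ _ setT openT)// mulr_sumr; apply: eq_bigr => i _.
have dc : differentiable (cmp F i) z by have [] := C1on_smooth i sF (x := z) I.
have dcy : differentiable (fun z => cmp F i z - y ord0 i) z.
  exact: (differentiableD dc (differentiable_cst _ z)).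
rewrite (pdM k dcy dcy) (pdD k dc (differentiable_cst _ z)) pd_cst addr0 mxE.
by rewrite mulr_natl mulr2n.
Qed.

(* [F xi = y] is solved near an interior image by minimising [|F xi - y|^2]
   over the cube: for [y] close to [x] the minimiser is interior, so it is a
   critical point, and the Jacobian is invertible there. *)
Lemma open_Omega : open (Omega F).
Proof.
rewrite openE => x [xi0 oxi0 Fx].
(* The fibre of [x] in the closed cube is the single interior point [xi0], so a cube point whose
   image is close to [x] is interior as well. *)
have [r r0 Hr] : exists2 r : R, 0 < r & forall xi, cube_cl xi -> ball x r (F xi) -> cube_open xi.
  have /nbhs_ballP[r /= r0 Hr] := @fibre_near x _ (@open_cube R d)
    (fun xi cxi Fxi => eq_ind xi0 (fun z => cube_open z) oxi0 xi
      (diffeo_inj (cube_open_cl oxi0) cxi (etrans Fx (esym Fxi)))).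
  by exists r => // xi cxi Bxi; exact: (Hr _ Bxi _ cxi).
have r20 : 0 < r / 2 by rewrite divr_gt0.
have qx : nbhs x [set y | sqdist x y < (r / 2) ^+ 2].
  have H : nbhs (sqdist x x) [set t : R | t < (r / 2) ^+ 2].
    apply: open_nbhs_nbhs; split; first exact: open_lt.
    by rewrite /= /sqdist big1 ?exprn_gt0// => i _; rewrite subrr mul0r.
  exact: (@continuous_sqdist x x _ H).
have bx : nbhs x (ball x (r / 2)) by exact: nbhsx_ballx.
apply: (filterS2 _ _ bx qx) => y yx /= qxy {bx qx}.
have [c cc cmin] := @continuous_attains_min (fun z => sqdist y (F z))
  (fun z => continuous_comp (diffeo_continuous (x := z)) (continuous_sqdist (y := y) (x := F z))).
(* Comparing the minimiser with [xi0] puts each coordinate of [F c] within r/2 of [y]; as [y] is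
   within r/2 of [x], the choice of [r] makes [c] interior. *)
have qmin : sqdist y (F c) < (r / 2) ^+ 2.
  apply: le_lt_trans (cmin _ (cube_open_cl oxi0)) _; rewrite /= Fx.
  rewrite (_ : sqdist y x = sqdist x y)//; apply: eq_bigr => i _.
  by rewrite -opprB mulrNN.
have oc : cube_open c.
  apply: (Hr c) => //; rewrite [r]splitr; apply: (ball_triangle yx).
  apply/(rV_ballP _ _ r20) => i; rewrite distrC -ltr_sqr ?nnegrE//; last exact: ltW.
  rewrite real_normK ?num_real//; apply: le_lt_trans qmin.
  rewrite /sqdist (bigD1 i)//= expr2 lerDl sumr_ge0// => k _.
  by rewrite -expr2 sqr_ge0.
exists c => //; apply/eqP; rewrite -subr_eq0.
have crit k : \sum_i (F c ord0 i - y ord0 i) * jac F c i k = 0.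
  have [e e0 He] : exists2 e : R, 0 < e & forall h : R, -e < h < e ->
      cube_cl (h *: delta_mx 0 k + c).
    have /nbhs_ballP[e /= e0 He] : nbhs c [set xi : 'rV[R]_d | cube_open xi].
      by apply: open_nbhs_nbhs; split => //; exact: open_cube.
    exists e => // h he; apply: cube_open_cl; apply: He.
    apply/(rV_ballP _ _ e0) => i; rewrite !mxE eqxx /=.
    rewrite opprD addrCA subrr addr0 normrN normrM.
    rewrite -ltr_norml in he; apply: le_lt_trans he; rewrite ler_piMr//.
    by case: (_ == _); rewrite ?normr1 ?normr0.
  have dq z : differentiable (fun z => sqdist y (F z)) z.
    by have [] := C1on_sqdist y (x := z) I.
  have e0e : (0 : R) \in `]-e, e[%R by rewrite in_itv /= oppr_lt0 e0.
  have [|||_ D0] := @derive1_at_min R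
     (fun h : R => sqdist y (F (h *: delta_mx 0 k + c))) (- e) e 0 _ _ e0e.
  - by rewrite ge0_cp// ltW.
  - move=> t _; have := derivable_line (diff_derivable (dq (t *: delta_mx 0 k + c)) (v := delta_mx 0 k)).
    by case.
  - move=> t; rewrite in_itv /= scale0r add0r => te; apply: cmin; exact: He.
  move: D0; rewrite -(derive_lineE (fun z => sqdist y (F z))) -/(pd k _ c) pd_sqdist.
  by move=> /eqP; rewrite mulf_eq0 pnatr_eq0 => /eqP.
have : (F c - y) *m jac F c = 0.
  by apply/rowP => k; rewrite !mxE -[RHS](crit k); apply: eq_bigr => i _; rewrite !mxE.
have Ju : jac F c \in unitmx by rewrite unitmxE unitfE; exact: diffeo_regular cc.
by move=> /(congr1 (mulmx^~ (invmx (jac F c)))); rewrite mulmxK// mul0mx => ->.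
Qed.

End InverseMap.

(** * Differentiability of the inverse and the chain rule on the image *)

Section PullBack.
Variables (R : realType) (d : nat) (F : fld R d).
Hypothesis dF : diffeo_cube F.

Let sF : smooth F. Proof. by case: dF. Qed.

(** The default value [0] is taken only off [Omega F]. *)
Definition preim_cube (x : 'rV[R]_d) : 'rV[R]_d :=
  xget 0 [set xi | cube_open xi /\ F xi = x].
Local Notation G := preim_cube.

Lemma preim_cubeP x : Omega F x -> cube_open (G x) /\ F (G x) = x.
Proof.
by move=> [xi oxi Fxi]; rewrite /G; case: xgetP => [y _ //|/(_ xi)[]]; split.
Qed.

Lemma preim_cubeK xi : cube_open xi -> G (F xi) = xi.
Proof.
move=> oxi; have [oG FG] := @preim_cubeP (F xi) (ex_intro2 _ _ xi oxi erefl).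
by apply: (diffeo_inj dF) => //; exact: cube_open_cl.
Qed.

Lemma near_Omega x : Omega F x -> \forall y \near x, Omega F y.
Proof. by move=> Ox; apply: open_nbhs_nbhs; split => //; exact: open_Omega. Qed.

Lemma continuous_preim_cube x : Omega F x -> {for x, continuous G}.
Proof.
move=> Ox; have [oG FG] := preim_cubeP Ox.
move=> A; rewrite nbhsE => -[U [oU UG] UA].
have N : \forall y \near x, forall xi, cube_cl xi -> F xi = y -> U xi.
  apply: (fibre_near dF) => // xi cxi Fxi.
  by rewrite (_ : xi = G x)//; apply: (diffeo_inj dF); rewrite ?FG//; exact: cube_open_cl.
apply: (filterS2 _ _ N (near_Omega Ox)) => y Uy /preim_cubeP[oGy FGy].
by apply: UA; apply: Uy => //; exact: cube_open_cl.
Qed.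

(** Points and directions are row vectors, while the rows of [jac] are indexed by the components of
    [F]; hence the transpose. *)
Lemma diff_jac xi v : 'd F xi v = v *m (jac F xi)^T.
Proof.
have dFx : differentiable F xi by exact: smooth_differentiable.
rewrite -(deriveE _ dFx) deriveEjacobian//; congr (_ *m _).
apply/matrixP => i j; rewrite !mxE pd_cmp// /cmp /jacobian /lin1_mx mxE.
Qed.

(** The summand 1 in the witness keeps the constant positive even for the zero matrix, so that it
    can be divided by. *)
Lemma mulmx_row_bound (A : 'M[R]_d) : exists2 C : R, 0 < C &
  forall r : 'rV[R]_d, `|r *m A| <= C * `|r|.
Proof.
exists (1 + \sum_i \sum_j `|A j i|).
  by rewrite ltr_pwDl// sumr_ge0// => i _; rewrite sumr_ge0.
move=> r; rewrite [leLHS]/Num.Def.normr /= mx_normrE.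
apply: bigmax_le; first by rewrite mulr_ge0// addr_ge0// sumr_ge0// => i _; rewrite sumr_ge0.
move=> [i j] _ /=; rewrite (ord1 i) mxE; apply: le_trans (ler_norm_sum _ _ _) _.
apply: (@le_trans _ _ (\sum_k `|A k j| * `|r|)).
  apply: ler_sum => k _; rewrite normrM mulrC ler_wpM2l//.
  rewrite [leRHS]/Num.Def.normr /= mx_normrE.
  exact: (le_bigmax _ (fun ij => `|r ij.1 ij.2|) (ord0, k)).
rewrite -mulr_suml ler_wpM2r// [X in _ <= 1 + X](bigD1 j)//= addrCA lerDl addr_ge0//.
by rewrite sumr_ge0// => k _; rewrite sumr_ge0.
Qed.

(** With k = G(x + hv) - G(x), the expansion of [F] at [G x] reads hv = kJ + o(|k|), where k tends
    to 0 by continuity of [G]. Absorbing the error gives |k| = O(|h|), so the error is o(h) and k/h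
    tends to v times the inverse of J. *)
Lemma is_derive_preim_cube x v : Omega F x ->
  is_derive x v G (v *m invmx (jac F (G x))^T).
Proof.
move=> Ox; have [oG FG] := preim_cubeP Ox.
set J := (jac F (G x))^T; set w := v *m invmx J.
have Ju : J \in unitmx.
  by rewrite unitmx_tr unitmxE unitfE; exact/(diffeo_regular dF)/cube_open_cl.
have [C C0 HC] := mulmx_row_bound (invmx J).
suff H : (fun h : R => h^-1 *: (G (h *: v + x) - G x)) @ 0^' --> w.
  by apply: DeriveDef; [apply/cvg_ex; exists w | exact: cvg_lim H].
apply/cvgrPdist_le => e e0.
(* The first bound gives m C <= 1/2, which absorbs |k| and yields |k| <= 2 |h| |w|; the second makes
   the remaining error at most e |h|. Using |w| + 1 avoids a zero denominator. *)
pose m := Num.min (2^-1 / C) (e / (2 * (`|w| + 1) * C)).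
have w1 : 0 < 2 * (`|w| + 1) * C by rewrite !mulr_gt0// ltr_pwDr.
have m0 : 0 < m by rewrite lt_min !divr_gt0.
have mC : m * C <= 2^-1 by rewrite -ler_pdivlMr// ge_min lexx.
have mw : m * C * (2 * (`|w| + 1)) <= e.
  by rewrite -mulrA [C * _]mulrC -ler_pdivlMr// ge_min lexx orbT.
have dFG : differentiable F (G x) by exact: smooth_differentiable.
have expand : \forall k \near (0 : 'rV[R]_d), `|F (k + G x) - x - k *m J| <= m * `|k|.
  have /eqaddoP/(_ m m0) := diff_locally dFG.
  apply: filterS => k /=.
  rewrite -![(_ - _ : _ -> _) _]/(_ - _) -![(_ + _ : _ -> _) _]/(_ + _) /=.
  by rewrite FG diff_jac opprD addrA.
have cG : (fun y => G y - G x) @ x --> (0 : 'rV[R]_d).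
  have cGx : G @ x --> G x := continuous_preim_cube Ox.
  exact: ((@subr_cvg0 _ _ _ _ _ G (G x)).2 cGx).
have near1 : \forall y \near x, Omega F y /\
    `|y - x - (G y - G x) *m J| <= m * `|G y - G x|.
  apply: (filterS2 _ _ (near_Omega Ox) (cG _ expand)) => y Oy /= Hy; split => //.
  by move: Hy; rewrite subrK (preim_cubeP Oy).2.
have line : (fun h : R => h *: v + x) @ 0^' --> x.
  have K : (fun h : R => h *: v + x) @ (0 : R) --> 0 *: v + x.
    apply: (@continuousD _ _ _ (fun h : R => h *: v) (cst x) 0); last exact: cst_continuous.
    exact: scalel_continuous.
  by rewrite scale0r add0r in K; exact: cvg_within_filter K.
have N := line _ near1.
near=> h.
have h0 : h != 0 by near: h; exact: nbhs_dnbhs_neq.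
have [_] : Omega F (h *: v + x) /\
    `|h *: v + x - x - (G (h *: v + x) - G x) *m J| <= m * `|G (h *: v + x) - G x|.
  by near: h; exact: N.
rewrite addrK; set k := G _ - G x => Hk.
have k1 : `|h *: w - k| <= C * (m * `|k|).
  have -> : h *: w - k = (h *: v - k *m J) *m invmx J.
    by rewrite mulmxBl mulmxK// -scalemxAl.
  by apply: le_trans (HC _) _; rewrite ler_pM2l.
have k2 : `|k| <= 2 * `|h| * `|w|.
  have : `|k| <= `|h| * `|w| + 2^-1 * `|k|.
    rewrite -{1}(subKr (h *: w) k) (le_trans (ler_normB _ _))// normrZ lerD2l.
    by rewrite (le_trans k1)// mulrA ler_wpM2r// mulrC.
  by rewrite -mulrA; move: (`|k|) (`|h| * `|w|) => a b ab; lra.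
have -> : w - h^-1 *: k = h^-1 *: (h *: w - k).
  by rewrite [RHS]scalerBr scalerA mulVf// scale1r.
rewrite normrZ normfV mulrC ler_pdivrMr ?normr_gt0//.
apply: (le_trans k1); apply: le_trans (ler_wpM2r (normr_ge0 h) mw).
have -> : m * C * (2 * (`|w| + 1)) * `|h| = C * (m * (2 * `|h| * (`|w| + 1))).
  by move: (`|w|) (`|h|) => a b; ring.
rewrite ler_pM2l// ler_pM2l//; apply: (le_trans k2).
by rewrite ler_wpM2l ?lerDl// mulr_ge0.
Unshelve. all: by end_near.
Qed.

Let dpreim xi (oxi : cube_open xi) : Omega F (F xi) := ex_intro2 _ _ xi oxi erefl.

(** Only directional derivatives of the inverse are at hand, so the chain rule is applied to [h]
    composed with the curve t -> G(tv + F xi), a differentiable function of one variable. *)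
Lemma is_derive_pull (g h : 'rV[R]_d -> R) xi v : cube_open xi ->
  (forall eta, cube_open eta -> g (F eta) = h eta) -> differentiable h xi ->
  is_derive (F xi) v g (\sum_k (v *m invmx (jac F xi)^T) ord0 k * pd k h xi).
Proof.
move=> oxi gh dh; have Ox := dpreim oxi.
have N : \forall y \near F xi, h (G y) = g y.
  by apply: filterS (near_Omega Ox) => y /preim_cubeP[oy Fy]; rewrite -gh// Fy.
apply: (near_eq_is_derive N).
apply: is_derive_line; set w := _ *m _.
have := is_derive_preim_cube v Ox; rewrite preim_cubeK// -/w => -[dG eG].
have dc : differentiable (fun t : R => G (t *: v + F xi)) 0.
  by apply/derivable1_diffP; exact: (derivable1P _ _ _).1.
have dh' : differentiable h ((fun t : R => G (t *: v + F xi)) 0).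
  by rewrite scale0r add0r preim_cubeK.
have dcomp := differentiable_comp dc dh'.
apply: DeriveDef; first exact/derivable1_diffP.
rewrite (deriveE _ dcomp) diff_comp//=.
have -> : 'd (fun t : R => G (t *: v + F xi)) 0 1 = w.
  by rewrite -deriveE// -derive_lineE eG.
rewrite scale0r add0r preim_cubeK//.
rewrite [in LHS](row_sum_delta w) linear_sum; apply: eq_bigr => k _.
by rewrite linearZ pdE.
Qed.

End PullBack.

(** * Transport to the physical domain and the Piola identity *)

Section PullClasses.
Variables (R : realType) (d : nat) (F : fld R d).
Hypothesis dF : diffeo_cube F.
Implicit Types (f g h q : 'rV[R]_d -> R) (xi x : 'rV[R]_d) (j : 'I_d).

Let sF : smooth F. Proof. by case: dF. Qed.
Let oreg : open (regular F). Proof. exact: open_regular. Qed.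

(* [pull0], [pull1]: on [Omega F] the function is the transport of a function that is
   continuous, resp. C^1, up to the boundary of the reference cube; [pullv] moreover
   asks for zero boundary values. *)
Definition pull0 g := exists2 q, (forall xi, cube_cl xi -> {for xi, continuous q}) &
  forall xi, cube_open xi -> g (F xi) = q xi.
Definition pull1 g := exists2 h, C1on (regular F) h &
  forall xi, cube_open xi -> g (F xi) = h xi.
Definition pullv g := exists h, [/\ C1on (regular F) h,
  forall xi, cube_open xi -> g (F xi) = h xi &
  forall xi, cube_cl xi -> ~ cube_open xi -> h xi = 0].

Lemma pullv_pull1 g : pullv g -> pull1 g.
Proof. by case=> h [? ? _]; exists h. Qed.

Lemma pull1_pull0 g : pull1 g -> pull0 g.
Proof.
case=> h Ch gh; exists h => // xi cxi.
exact: C1on_continuous Ch (diffeo_regular dF cxi).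
Qed.

Lemma eq_pull0 f g : (forall x, Omega F x -> f x = g x) -> pull0 f -> pull0 g.
Proof.
move=> fg [q cq fq]; exists q => // xi oxi; rewrite -fg ?fq//; by exists xi.
Qed.

Lemma pull0_cst c : pull0 (fun=> c).
Proof. by exists (fun=> c) => // xi _; exact: cst_continuous. Qed.

Lemma pull0D f g : pull0 f -> pull0 g -> pull0 (fun x => f x + g x).
Proof.
move=> [q cq fq] [p cp gp]; exists (fun xi => q xi + p xi).
  by move=> xi cxi; apply: continuousD; [exact: cq | exact: cp].
by move=> xi oxi; rewrite fq ?gp.
Qed.

Lemma pull0M f g : pull0 f -> pull0 g -> pull0 (fun x => f x * g x).
Proof.
move=> [q cq fq] [p cp gp]; exists (fun xi => q xi * p xi).
  by move=> xi cxi; apply: continuousM; [exact: cq | exact: cp].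
by move=> xi oxi; rewrite fq ?gp.
Qed.

Lemma pull0N f : pull0 f -> pull0 (fun x => - f x).
Proof.
by move=> /(pull0M (pull0_cst (-1))); apply: eq_pull0 => x _; rewrite mulN1r.
Qed.

Lemma pull0_sum (I : Type) (r : seq I) (f : I -> 'rV[R]_d -> R) :
  (forall a, pull0 (f a)) -> pull0 (fun x => \sum_(a <- r) f a x).
Proof.
move=> H; elim: r => [|a r IH].
  by apply: eq_pull0 (pull0_cst 0) => x _; rewrite big_nil.
by apply: eq_pull0 (pull0D (H a) IH) => x _; rewrite big_cons.
Qed.

Lemma pull1_cst c : pull1 (fun=> c).
Proof. by exists (fun=> c) => //; exact: C1on_cst. Qed.

Lemma pull1D f g : pull1 f -> pull1 g -> pull1 (fun x => f x + g x).
Proof.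
move=> [q cq fq] [p cp gp]; exists (fun xi => q xi + p xi).
  exact: (C1onD oreg cq cp).
by move=> xi oxi; rewrite fq ?gp.
Qed.

Lemma pull1M f g : pull1 f -> pull1 g -> pull1 (fun x => f x * g x).
Proof.
move=> [q cq fq] [p cp gp]; exists (fun xi => q xi * p xi).
  exact: (C1onM oreg cq cp).
by move=> xi oxi; rewrite fq ?gp.
Qed.

Lemma pullvM f g : pullv f -> pull1 g -> pullv (fun x => f x * g x).
Proof.
move=> [q [cq fq q0]] [p cp gp]; exists (fun xi => q xi * p xi); split.
- exact: (C1onM oreg cq cp).
- by move=> xi oxi; rewrite fq ?gp.
- by move=> xi cxi nxi; rewrite q0 ?mul0r.
Qed.

Lemma pullvD f g : pullv f -> pullv g -> pullv (fun x => f x + g x).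
Proof.
move=> [q [cq fq q0]] [p [cp gp p0]]; exists (fun xi => q xi + p xi); split.
- exact: (C1onD oreg cq cp).
- by move=> xi oxi; rewrite fq ?gp.
- by move=> xi cxi nxi; rewrite q0 ?p0 ?addr0.
Qed.

Lemma C1on_detmx D n (M : 'rV[R]_d -> 'M[R]_n) : open D ->
  (forall a b, C1on D (fun x => M x a b)) -> C1on D (fun x => \det (M x)).
Proof.
move=> oD CM; apply: (C1on_sum oD) => s _.
by apply: (C1onM oD); [exact: C1on_cst | apply: (C1on_prod oD) => i _; exact: CM].
Qed.

Lemma C1on_cofactor i j : C1on setT (fun xi => cofactor (jac F xi) i j).
Proof.
apply: (C1onM openT); first exact: C1on_cst.
apply: (C1on_detmx openT) => k l.
by apply: eq_C1on (C1on_jac (lift i k) (lift j l) sF) => x; rewrite !mxE.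
Qed.

Lemma invmx_jacE xi i j : regular F xi ->
  invmx (jac F xi) i j = (\det (jac F xi))^-1 * cofactor (jac F xi) j i.
Proof.
by move=> rxi; rewrite /invmx unitmxE unitfE rxi !mxE.
Qed.

Lemma pd_pull g h j xi : cube_open xi -> (forall eta, cube_open eta -> g (F eta) = h eta) ->
  differentiable h xi ->
  derivable g (F xi) (delta_mx 0 j) /\
  pd j g (F xi) = \sum_k invmx (jac F xi) k j * pd k h xi.
Proof.
move=> oxi gh dh; have [D E] := is_derive_pull dF (delta_mx 0 j) oxi gh dh.
split => //; rewrite /pd E; apply: eq_bigr => k _; congr (_ * _).
by rewrite -rowE mxE -trmx_inv mxE.
Qed.

Lemma pull1_derivable g x j : pull1 g -> Omega F x -> derivable g x (delta_mx 0 j).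
Proof.
move=> [h Ch gh] [xi oxi <-].
have [dh _] := Ch xi (diffeo_regular dF (cube_open_cl oxi)).
by have [] := pd_pull j oxi gh dh.
Qed.

Let continuous_sum (I : Type) (r : seq I) (f : I -> 'rV[R]_d -> R) xi :
  (forall a, {for xi, continuous (f a)}) ->
  {for xi, continuous (fun x => \sum_(a <- r) f a x)}.
Proof.
move=> H; elim: r => [|a r IH].
  rewrite (_ : (fun _ => _) = fun=> 0); first exact: cst_continuous.
  by apply/funext => x; rewrite big_nil.
rewrite (_ : (fun _ => _) = fun x => f a x + \sum_(a <- r) f a x).
  by apply: continuousD; [exact: H | exact: IH].
by apply/funext => x; rewrite big_cons.
Qed.

(** The chain rule brings in the inverse Jacobian. By Cramer's rule its entries are cofactors over a
    determinant that does not vanish on the closed cube, so continuity extends up to the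
    boundary. *)
Lemma pull1_pd g j : pull1 g -> pull0 (pd j g).
Proof.
move=> [h Ch gh]; exists (fun xi =>
    \sum_k (\det (jac F xi))^-1 * cofactor (jac F xi) j k * pd k h xi).
  move=> xi cxi; have rxi := diffeo_regular dF cxi.
  apply: continuous_sum => k; apply: continuousM; last by have [_] := Ch xi rxi; apply.
  apply: continuousM; last exact: C1on_continuous (C1on_cofactor j k) _.
  by apply: continuousV => //; exact: C1on_continuous (C1on_det sF) _.
move=> xi oxi; have rxi := diffeo_regular dF (cube_open_cl oxi).
have [dh _] := Ch xi rxi; have [_ ->] := pd_pull j oxi gh dh.
by apply: eq_bigr => k _; rewrite invmx_jacE.
Qed.

Lemma pull1_pdM f g x j : pull1 f -> pull1 g -> Omega F x ->
  pd j (fun x => f x * g x) x = f x * pd j g x + g x * pd j f x.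
Proof. by move=> pf pg Ox; apply: derivable_pdM; exact: pull1_derivable. Qed.

Lemma pull1_pdD f g x j : pull1 f -> pull1 g -> Omega F x ->
  pd j (fun x => f x + g x) x = pd j f x + pd j g x.
Proof. by move=> pf pg Ox; apply: derivable_pdD; exact: pull1_derivable. Qed.

Lemma pull0_continuous g x : pull0 g -> Omega F x -> {for x, continuous g}.
Proof.
move=> [q cq gq] Ox; have [oG FG] := preim_cubeP Ox.
apply: (@continuous_near_eq _ _ _ (q \o preim_cube F)).
  apply: filterS (near_Omega dF Ox) => y /preim_cubeP[oy Fy].
  by rewrite /= -gq// Fy.
apply: continuous_comp; first exact: (continuous_preim_cube dF).
exact: cq (cube_open_cl oG).
Qed.

Lemma pull0_bounded g : pull0 g -> exists M : R, forall x, Omega F x -> `|g x| <= M.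
Proof.
move=> [q cq gq].
have cK : compact (q @` [set xi | cube_cl xi]).
  apply: continuous_compact; last exact: cube_compact.
  by apply/continuous_in_subspaceT => xi /[1!inE] cxi; exact: cq.
have [M [_ HM]] := compact_bounded cK.
(* [compact_bounded] provides a bound for every real strictly above [M], hence the [M + 1]. *)
exists (M + 1) => x [xi oxi <-]; rewrite gq//.
apply: HM; first by rewrite ltrDl.
by exists xi => //; exact: cube_open_cl.
Qed.

(** The points of the closed cube above [x], if any, lie on the boundary of the cube, where the
    reference function is zero. The open set where it is smaller than [e] thus contains the whole
    fibre, and [fibre_near] applies, also when the fibre is empty. *)
Lemma pullv_near g x (e : R) : pullv g -> ~ Omega F x -> 0 < e ->
  \forall y \near x, Omega F y -> `|g y| < e.
Proof.
move=> [h [Ch gh h0]] nOx e0.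
pose U := [set xi | regular F xi /\ `|h xi| < e].
have oU : open U.
  rewrite openE => xi [rxi hxi]; apply: filterI.
    exact: open_nbhs_nbhs.
  have N : nbhs (h xi) [set t : R | `|t| < e].
    rewrite (_ : [set _ | _] = ball (0 : R) e).
      by apply: open_nbhs_nbhs; split; [exact: ball_open | rewrite /ball /= sub0r normrN].
    by apply/seteqP; split => t; rewrite /ball /= sub0r normrN.
  exact: (C1on_continuous Ch rxi N).
have yU xi : cube_cl xi -> F xi = x -> U xi.
  move=> cxi Fxi; split; first exact: diffeo_regular.
  by rewrite h0 ?normr0// => oxi; apply: nOx; exists xi.
apply: filterS (fibre_near dF oU yU) => y Hy [xi oxi Fxi].
by rewrite -Fxi gh//; have [] := Hy xi (cube_open_cl oxi) Fxi.
Qed.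

End PullClasses.

(** * Jacobi's formula and the divergence of a Piola image *)

Section Piola.
Variables (R : realType) (d : nat).

Lemma pd_prod (T : eqType) (r : seq T) (f : T -> 'rV[R]_d -> R) x j : uniq r ->
  (forall a, C1on setT (f a)) ->
  pd j (fun x => \prod_(a <- r) f a x) x =
  \sum_(a <- r) pd j (f a) x * \prod_(b <- r | b != a) f b x.
Proof.
move=> + H; elim: r => [_|a r IH /= /andP[ar ur]].
  rewrite big_nil (_ : (fun _ => _) = fun=> 1) ?pd_cst//.
  by apply/funext => y; rewrite big_nil.
rewrite (_ : (fun _ => _) = fun x => f a x * \prod_(b <- r) f b x); last first.
  by apply/funext => y; rewrite big_cons.
have da := (H a x I).1; have dr := (C1on_prod openT r (P := xpredT) (fun a _ => H a) (x := x) I).1.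
rewrite (pdM j da dr) (IH ur) big_cons big_cons eqxx /= addrC; congr (_ + _).
  rewrite mulrC; congr (_ * _); rewrite [RHS]big_seq_cond [LHS]big_seq_cond.
  apply: eq_bigl => b; case br: (b \in r) => //=.
  by apply/esym/eqP => ba; rewrite -ba br in ar.
rewrite mulr_sumr [LHS]big_seq [RHS]big_seq; apply: eq_bigr => b br.
rewrite big_cons ifT; first by rewrite mulrCA.
by apply/eqP => ab; rewrite ab br in ar.
Qed.

Lemma pd_det (A : 'rV[R]_d -> 'M[R]_d) x j : (forall i l, C1on setT (fun x => A x i l)) ->
  pd j (fun x => \det (A x)) x =
  \sum_i \sum_l pd j (fun x => A x i l) x * cofactor (A x) i l.
Proof.
move=> CA; rewrite /determinant.
have Cs (s : 'S_d) : C1on setT (fun x => \prod_i A x i (s i)).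
  by apply: (C1on_prod openT) => i _; exact: CA.
rewrite (@pd_sum _ _ setT openT)//; last first.
  by move=> s _; apply: (C1onM openT); [exact: C1on_cst | exact: Cs].
(* [B i] is the matrix with row i differentiated. The Leibniz formula for its determinant gives one
   term of the product rule; expansion along row i gives the cofactors, which do not see that
   row. *)
pose B i := \matrix_(k, l) if k == i then pd j (fun x => A x k l) x else A x k l.
transitivity (\sum_i \det (B i)); last first.
  apply: eq_bigr => i _; rewrite (expand_det_row _ i); apply: eq_bigr => l _.
  rewrite mxE eqxx; congr (_ * _); rewrite /cofactor; congr (_ * \det _).
  by apply/matrixP => k m; rewrite !mxE eq_sym (negPf (neq_lift _ _)).
rewrite /determinant exchange_big /=; apply: eq_bigr => s _.
rewrite (pdM j (differentiable_cst _ x) (Cs s x I).1) pd_cst mulr0 addr0 -mulr_sumr.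
congr (_ * _); rewrite pd_prod//; last exact: index_enum_uniq.
apply: eq_bigr => i _; rewrite [RHS](bigD1 i)//= mxE eqxx; congr (_ * _).
by apply: eq_bigr => k ki; rewrite mxE (negPf ki).
Qed.

(* The Piola transform preserves the divergence up to the factor [\det (jac F)]:
   the terms containing second derivatives of [F] cancel by Jacobi's formula and
   their symmetry. *)
Lemma piola_div0 (F P v : fld R d) xi : diffeo_cube F ->
  (forall l, C1on setT (cmp P l)) -> (forall eta, \sum_l pd l (cmp P l) eta = 0) ->
  (forall eta, cube_cl eta -> v (F eta) = (\det (jac F eta))^-1 *: (P eta *m (jac F eta)^T)) ->
  cube_open xi -> \sum_i pd i (cmp v i) (F xi) = 0.
Proof.
move=> dF CP divP vE oxi; have sF : smooth F by case: dF.
have rxi := diffeo_regular dF (cube_open_cl oxi).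
have oreg := open_regular sF.
pose s i eta := \sum_l P eta ord0 l * jac F eta i l.
pose h i eta := (\det (jac F eta))^-1 * s i eta.
have Cs i : C1on setT (s i).
  apply: (C1on_sum openT) => l _; apply: (C1onM openT); first exact: (CP l).
  exact: C1on_jac.
have Ch i : C1on (regular F) (h i).
  apply: (C1onM oreg); last by apply: C1on_subset (Cs i).
  by apply: (C1onV oreg) => //; apply: C1on_subset (C1on_det sF).
have vh i eta : cube_open eta -> cmp v i (F eta) = h i eta.
  move=> oeta; rewrite /cmp vE; last exact: cube_open_cl.
  rewrite !mxE; congr (_ * _); apply: eq_bigr => l _.
  by rewrite [in LHS]mxE.
set J := jac F xi; set D := \det J.
have D0 : D != 0 by exact: rxi.
have dh i : differentiable (h i) xi := (Ch i xi rxi).1.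
have dD : differentiable (fun x => \det (jac F x)) xi := (C1on_det sF (x := xi) I).1.
(* Differentiating the product det * h = s avoids differentiating 1/det. *)
have pds i k : D * pd k (h i) xi = pd k (s i) xi - h i xi * pd k (fun x => \det (jac F x)) xi.
  apply/eqP; rewrite eq_sym subr_eq -(pdM k dD (dh i)); apply/eqP.
  apply: near_pd; have : nbhs xi (regular F) by exact: open_nbhs_nbhs.
  by apply: filterS => y ry; rewrite /h mulrA mulfV// mul1r.
have E i : pd i (cmp v i) (F xi) = D^-1 * D^-1 * \sum_k cofactor J i k * (D * pd k (h i) xi).
  have [_ ->] := pd_pull dF i oxi (vh i) (dh i).
  rewrite mulr_sumr; apply: eq_bigr => k _; rewrite invmx_jacE// -/D -/J.
  by field.
rewrite (eq_bigr _ (fun i _ => E i)) -mulr_sumr.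
under eq_bigr => a _ do under eq_bigr => b _ do rewrite pds mulrBr.
under eq_bigr do rewrite sumrB.
rewrite sumrB; apply/eqP; rewrite mulf_eq0; apply/orP; right; rewrite subr_eq0; apply/eqP.
have adj i l : \sum_k cofactor J k i * J k l = D *+ (i == l).
  have := congr1 (fun M : 'M[R]_d => M i l) (mul_adj_mx J).
  rewrite [LHS]mxE [RHS]mxE => <-; apply: eq_bigr => k _.
  by rewrite [in RHS]mxE.
have pdsE i k : pd k (s i) xi = \sum_l
    (P xi ord0 l * pd k (fun x => jac F x i l) xi + J i l * pd k (cmp P l) xi).
  rewrite (@pd_sum _ _ setT openT)//; last first.
    move=> l _; apply: (C1onM openT); first exact: (CP l).
    exact: C1on_jac.
  by apply: eq_bigr => l _; rewrite (pdM k (CP l xi I).1 (C1on_jac i l sF (x := xi) I).1).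
(* Both sides equal the derivative of the determinant along [P]. On the left, the part with
   derivatives of [P] collapses by the adjugate identity to D times the divergence of [P], and the
   rest is Jacobi's formula after swapping second derivatives. On the right, cofactors times [h]
   give back [P], again by the adjugate identity. *)
transitivity (\sum_l P xi ord0 l * pd l (fun x => \det (jac F x)) xi).
  under eq_bigr => a _ do under eq_bigr => b _ do rewrite pdsE big_split mulrDr.
  under eq_bigr do rewrite big_split.
  rewrite big_split /= [X in _ + X](_ : _ = 0) ?addr0; last first.
    under eq_bigr => a _ do under eq_bigr => b _ do rewrite mulr_sumr.
    rewrite exchange_big /=; under eq_bigr => a _ do rewrite exchange_big /=.
    transitivity (\sum_k \sum_l (D *+ (k == l)) * pd k (cmp P l) xi).
      apply: eq_bigr => k _; apply: eq_bigr => l _.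
      by rewrite -adj mulr_suml; apply: eq_bigr => i _; rewrite mulrA.
    transitivity (\sum_k D * pd k (cmp P k) xi); last by rewrite -mulr_sumr divP mulr0.
    apply: eq_bigr => k _; rewrite (bigD1 k)//= eqxx big1 ?addr0// => l lk.
    by rewrite eq_sym (negPf lk) mulr0n mul0r.
  under [RHS]eq_bigr do rewrite (pd_det xi _ (fun i l => C1on_jac i l sF)) mulr_sumr.
  rewrite [RHS]exchange_big /=; apply: eq_bigr => i _.
  under [RHS]eq_bigr do rewrite mulr_sumr.
  rewrite [RHS]exchange_big /=; apply: eq_bigr => k _; rewrite mulr_sumr.
  apply: eq_bigr => l _; rewrite (pd_jac_sym i l k xi sF) -/J.
  by rewrite mulrCA [cofactor _ _ _ * _]mulrC.
rewrite exchange_big /=; apply: eq_bigr => k _.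
under eq_bigr do rewrite mulrA; rewrite -mulr_suml; congr (_ * _).
rewrite /h /s -/D -/J.
under eq_bigr do rewrite mulrCA mulr_sumr.
rewrite -mulr_sumr exchange_big /=.
transitivity (D^-1 * \sum_l P xi ord0 l * (D *+ (k == l))).
  rewrite (bigD1 k)//= eqxx big1 ?addr0; last first.
    by move=> l lk; rewrite eq_sym (negPf lk) mulr0n mulr0.
  by rewrite mulr1n mulrCA mulVf ?mulr1.
congr (_ * _); apply: eq_bigr => l _; rewrite -adj mulr_sumr; apply: eq_bigr => i _.
by rewrite mulrCA.
Qed.

End Piola.

(** * Integration *)

Section LineIntegrals.
Variable R : realType.
Notation mu := (@lebesgue_measure R).
Notation measurableR := (@measurable _ (measurableTypeR R)).
Implicit Types (h k : R -> R) (a b C : R) (A : set R).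

Lemma open_itv_bounds A : open A -> is_interval A -> A !=set0 ->
  has_lbound A -> has_ubound A -> exists a b, a < b /\ A = `]a, b[%classic.
Proof.
move=> oA iA [x0 Ax0] lA uA.
have lt_sup x : A x -> x < sup A.
  move=> Ax; have /nbhs_ballP[r /= r0 Hr] := open_nbhs_nbhs (conj oA Ax).
  have : A (x + r / 2).
    by apply: Hr; rewrite /ball /= opprD addNKr normrN gtr0_norm ?divr_gt0//; lra.
  by move=> /(ub_le_sup uA); apply: lt_le_trans; rewrite ltrDl divr_gt0.
have gt_inf x : A x -> inf A < x.
  move=> Ax; have /nbhs_ballP[r /= r0 Hr] := open_nbhs_nbhs (conj oA Ax).
  have : A (x - r / 2).
    by apply: Hr; rewrite /ball /= opprB addrC subrK gtr0_norm ?divr_gt0//; lra.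
  by move=> /(ge_inf lA) H; apply: le_lt_trans H _; rewrite ltrBlDr ltrDl divr_gt0.
exists (inf A), (sup A); split; first exact: lt_trans (gt_inf _ Ax0) (lt_sup _ Ax0).
apply/seteqP; split => x /=; rewrite in_itv /=.
  by move=> Ax; rewrite gt_inf ?lt_sup.
move=> /andP[ix xs].
have hi : has_inf A by split => //; exists x0.
have hs : has_sup A by split => //; exists x0.
have [y Ay yx] := inf_lt hi.1 ix.
have [z Az xz] := sup_gt hs.1 xs.
by apply: (iA y z) => //; rewrite !ltW.
Qed.

Lemma Rintegral_bound A k C : measurableR A -> (mu A < +oo)%E ->
  mu.-integrable A (EFin \o k) -> (forall t, A t -> `|k t| <= C) ->
  `|\int[mu]_(t in A) k t| <= C * fine (mu A).
Proof.
move=> mA Afin ik kC; apply: le_trans (le_normr_Rintegral mA ik) _.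
rewrite -Rintegral_cst//; apply: le_Rintegral => //.
  exact: integrable_norm.
apply: measurable_bounded_integrable => //.
by exists `|C|; split; [exact: num_real | move=> r Cr t _; exact: ltW].
Qed.

(** The values of [h] at [a] and [b] are unconstrained, so the fundamental theorem is used on an
    inner interval [s, t] with ends at distance at most e from [a] and [b]. The two end pieces
    contribute at most C e each and h(s), h(t) less than e each, whence the constant 2C + 2. *)
Lemma Rintegral_deriv_oo h k a b C : a < b ->
  (forall t, a < t < b -> [/\ is_derive t 1 h (k t), {for t, continuous k} & `|k t| <= C]) ->
  mu.-integrable `]a, b[ (EFin \o k) ->
  (forall e, 0 < e -> \forall s \near a, a < s < b -> `|h s| < e) ->
  (forall e, 0 < e -> \forall s \near b, a < s < b -> `|h s| < e) ->
  \int[mu]_(t in `]a, b[) k t = 0.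
Proof.
move=> ab H ik ha hb; set I := \int[mu]_(t in _) _.
have C0 : 0 <= C.
  have [_ _] := H ((a + b) / 2) ltac:(by apply/andP; split; lra).
  by move=> Ck; exact: le_trans (normr_ge0 _) Ck.
suff small e : 0 < e -> `|I| <= e * (2 * C + 2).
  apply/eqP; rewrite -normr_le0; apply/ler_addgt0Pl => e e0; rewrite addr0.
  have c2 : 0 < 2 * C + 2 by lra.
  have := small (e / (2 * C + 2)); rewrite divfK ?gt_eqF//; apply.
  by rewrite divr_gt0.
move=> e0.
have pick c : (forall e, 0 < e -> \forall s \near c, a < s < b -> `|h s| < e) ->
    exists2 r, 0 < r < (b - a) / 2 /\ r <= e &
      forall s, `|c - s| <= r -> a < s < b -> `|h s| < e.
  move=> /(_ e e0) /nbhs_ballP[r /= r0 Hr].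
  (* Dividing by 4 keeps each end piece shorter than half of the interval, so that s < t, and makes
     the closed condition on the distance fit into the open ball. *)
  pose q := Num.min r (Num.min e (b - a)).
  have q0 : 0 < q by rewrite !lt_min r0 e0 subr_gt0.
  have qr : q <= r by rewrite ge_min lexx.
  have qe : q <= e by rewrite !ge_min lexx orbT.
  have qb : q <= b - a by rewrite !ge_min lexx !orbT.
  exists (q / 4); first by split; [apply/andP; split; lra | lra].
  by move=> s cs; apply: Hr; rewrite /ball /=; apply: le_lt_trans cs _; lra.
have [r [/andP[r0 rb] re] Hr] := pick a ha.
have [q [/andP[q0 qb] qe] Hq] := pick b hb.
set s := a + r; set t := b - q.
have as_ : a < s by rewrite /s; lra.
have st : s < t by rewrite /s /t; lra.
have tb : t < b by rewrite /t; lra.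
have isub (i : interval R) : [set` i] `<=` `]a, b[%classic -> mu.-integrable [set` i] (EFin \o k).
  by move=> ii; apply: integrableS ik => //; exact: measurable_itv.
have sub1 : `]a, s] `<=` `]a, b[%classic.
  by move=> x /=; rewrite !in_itv /= => /andP[-> xs]; rewrite (le_lt_trans xs)// (lt_trans st).
have sub2 : `]t, b[ `<=` `]a, b[%classic.
  by move=> x /=; rewrite !in_itv /= => /andP[tx ->]; rewrite andbT; lra.
have sub3 : `]s, b[ `<=` `]a, b[%classic.
  by move=> x /=; rewrite !in_itv /= => /andP[tx ->]; rewrite andbT; lra.
have sub4 : `]s, t] `<=` `]a, b[%classic.
  by move=> x /=; rewrite !in_itv /= => /andP[sx xt]; apply/andP; split; lra.
have sub5 : `[s, t] `<=` `]a, b[%classic.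
  by move=> x /=; rewrite !in_itv /= => /andP[sx xt]; apply/andP; split; lra.
have E1 : I = \int[mu]_(x in `]a, s]) k x + \int[mu]_(x in `]s, b[) k x.
  apply/eqP; rewrite addrC -subr_eq; apply/eqP; apply: Rintegral_itvB => //.
  - by rewrite bnd_simp ltW.
  - by rewrite bnd_simp; lra.
have E2 : \int[mu]_(x in `]s, b[) k x =
    \int[mu]_(x in `]s, t]) k x + \int[mu]_(x in `]t, b[) k x.
  apply/eqP; rewrite addrC -subr_eq; apply/eqP; apply: Rintegral_itvB => //.
  - exact: isub.
  - by rewrite bnd_simp ltW.
have E3 : \int[mu]_(x in `]s, t]) k x = h t - h s.
  rewrite Rintegral_itv_obnd_cbnd; last exact: isub.
  have dh x : x \in `[s, t]%R -> is_derive x 1 h (k x).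
    by rewrite in_itv /= => /andP[sx xt]; have [|//] := H x; apply/andP; split; lra.
  have ch : {within `[s, t], continuous h}.
    by apply: derivable_within_continuous => x /dh[].
  rewrite /Rintegral (continuous_FTC2 (F := h) st)//.
  - apply/continuous_in_subspaceT => x /[1!inE] /=; rewrite in_itv /= => /andP[sx xt].
    by have [|//] := H x; apply/andP; split; lra.
  - have [_ c1 c2] := (continuous_within_itvP h st).1 ch; split => // x.
    by move=> /subset_itv_oo_cc /dh[].
  - by move=> x /subset_itv_oo_cc /dh[_ <-]; rewrite derive1E.
have bnd x y : x < y -> fine (mu `]x, y]) = y - x /\ fine (mu `]x, y[) = y - x.
  by move=> xy; rewrite !lebesgue_measure_itv /= lte_fin xy -EFinB.
have B1 : `|\int[mu]_(x in `]a, s]) k x| <= C * r.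
  have -> : r = fine (mu `]a, s]) by rewrite (bnd _ _ as_).1 /s; lra.
  apply: Rintegral_bound => //.
  - by rewrite lebesgue_measure_itv /= lte_fin as_ -EFinB ltry.
  - exact: isub.
  - by move=> x /sub1 /=; rewrite in_itv /= => /H[].
have B2 : `|\int[mu]_(x in `]t, b[) k x| <= C * q.
  have -> : q = fine (mu `]t, b[) by rewrite (bnd _ _ tb).2 /t; lra.
  apply: Rintegral_bound => //.
  - by rewrite lebesgue_measure_itv /= lte_fin tb -EFinB ltry.
  - exact: isub.
  - by move=> x /sub2 /=; rewrite in_itv /= => /H[].
have B3 : `|h s| < e.
  by apply: Hr; [rewrite /s opprD addNKr normrN gtr0_norm | apply/andP; split; lra].
have B4 : `|h t| < e.
  by apply: Hq; [rewrite /t opprB addrC subrK gtr0_norm | apply/andP; split; lra].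
rewrite E1 E2 E3.
have C1 : C * r <= e * C by rewrite mulrC ler_wpM2r.
have C2 : C * q <= e * C by rewrite mulrC ler_wpM2r.
apply: le_trans (ler_normD _ _) _; apply: le_trans (lerD B1 (ler_normD _ _)) _.
have := ler_normB (h t) (h s); move: B2 B3 B4 C1 C2.
move: (`|h t|) (`|h s|) (`|h t - h s|) (`|Rintegral _ _ _|) => v1 v2 v3 v4.
have -> : e * (2 * C + 2) = e * C + e * C + 2 * e by ring.
move: (C * r) (C * q) (e * C) => w1 w2 w3 *; lra.
Qed.

(* The set is a countable disjoint union of open intervals whose end points lie
   outside of it, and [h] tends to [0] there. *)
Lemma integral_deriv_open A h k C M : open A -> (forall t, A t -> `|t| <= M) ->
  (forall t, A t -> [/\ is_derive t 1 h (k t), {for t, continuous k} & `|k t| <= C]) ->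
  (forall t e, ~ A t -> 0 < e -> \forall s \near t, A s -> `|h s| < e) ->
  (\int[mu]_(t in A) (k t)%:E = 0)%E.
Proof.
move=> oA AM H h0.
have mA : measurableR A by exact: open_measurable.
have Afin : (mu A < +oo)%E.
  apply: (@le_lt_trans _ _ (mu `[- M, M])).
    apply: le_measure; rewrite ?inE//.
    by move=> t /AM /=; rewrite in_itv /= ler_norml.
  by rewrite lebesgue_measure_itv /=; case: ifP => _; rewrite -?EFinB ltry.
have ik : mu.-integrable A (EFin \o k).
  apply: measurable_bounded_integrable => //.
    apply: open_continuous_measurable_fun => // t /[1!inE] At.
    by have [] := H t At.
  exists C; split; first exact: num_real.
  by move=> r Cr t At; have [_ _ kC] := H t At; exact: le_trans kC (ltW Cr).
rewrite (open_disjoint_itv_bigcup oA) integral_bigcup; first last.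
- by rewrite -open_disjoint_itv_bigcup.
- by move=> q; apply: open_measurable; exact: open_disjoint_itv_open.
- exact: open_disjoint_itv_trivIset.
rewrite eseries0// => q _ _.
set I := open_disjoint_itv oA q.
have IA : I `<=` A.
  by rewrite (open_disjoint_itv_bigcup oA) => x Ix; exists q.
have oI : open I by exact: open_disjoint_itv_open.
have [-> |/set0P I0] := eqVneq I set0; first by rewrite integral_set0.
have [||a [b [ab Iab]]] := open_itv_bounds oI (@open_disjoint_itv_is_interval _ _ oA q) I0.
- by exists (- M) => t /IA /AM; rewrite ler_norml => /andP[].
- by exists M => t /IA /AM; rewrite ler_norml => /andP[].
(* A limit point of the component [I] that belongs to the set but not to [I] would lie in another
   component; that component is open, so it would meet [I], against disjointness. *)
have outside c : ~ I c -> (forall r, 0 < r -> exists2 s, `|c - s| < r & I s) -> ~ A c.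
  move=> nIc Ic; rewrite (open_disjoint_itv_bigcup oA) => -[p _ pc].
  have /nbhs_ballP[r /= r0 Hr] := open_nbhs_nbhs (conj (@open_disjoint_itv_open _ _ oA p) pc).
  have [s cs Is] := Ic r r0.
  have pq : p = q.
    apply: (@open_disjoint_itv_trivIset _ _ oA) => //; exists s; split => //; exact: Hr.
  by apply: nIc; rewrite /I -pq.
have nAa : ~ A a.
  apply: outside; first by rewrite Iab /= in_itv /= ltxx.
  move=> r r0; pose m := Num.min r (b - a).
  have m0 : 0 < m by rewrite lt_min r0 subr_gt0.
  have [mr mb] : m <= r /\ m <= b - a by rewrite !ge_min !lexx orbT.
  exists (a + m / 2); first by rewrite opprD addNKr normrN gtr0_norm ?divr_gt0//; lra.
  by rewrite Iab /= in_itv /=; apply/andP; split; lra.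
have nAb : ~ A b.
  apply: outside; first by rewrite Iab /= in_itv /= ltxx andbF.
  move=> r r0; pose m := Num.min r (b - a).
  have m0 : 0 < m by rewrite lt_min r0 subr_gt0.
  have [mr mb] : m <= r /\ m <= b - a by rewrite !ge_min !lexx orbT.
  exists (b - m / 2); first by rewrite opprB addrC subrK gtr0_norm ?divr_gt0//; lra.
  by rewrite Iab /= in_itv /=; apply/andP; split; lra.
have inI t : a < t < b -> A t by move=> tab; apply: IA; rewrite Iab /= in_itv.
have iI : mu.-integrable `]a, b[ (EFin \o k).
  by rewrite -Iab; apply: integrableS ik => //; exact: open_measurable.
have := @Rintegral_deriv_oo h k a b C ab (fun t tab => H t (inI t tab)) iI.
rewrite /Rintegral => E; rewrite Iab -[LHS]fineK; last exact: integrable_fin_num.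
rewrite E// => e e0.
- by apply: filterS (h0 a e nAa e0) => s Hs /inI.
- by apply: filterS (h0 b e nAb e0) => s Hs /inI.
Qed.

End LineIntegrals.

(** * Measurability and integrability through coordinates *)

Section CoordinateMeasurability.
Variables (R : realType) (d : nat) (disp : measure_display) (T : measurableType disp).
Variable row : T -> 'rV[R]_d.
Hypothesis mrow : forall i,
  measurable_fun [set: T] (fun t => row t ord0 i : measurableTypeR R).

(** Only the coordinates of [row] are known to be measurable. An open set is a countable union of
    boxes with rational centre and radius, and the preimage of a box is a finite intersection of
    coordinate conditions. *)
Lemma measurable_preim_open (O : set 'rV[R]_d) : open O -> measurable (row @^-1` O).
Proof.
move=> oO; pose K := ({ffun 'I_d -> rat} * rat)%type.
pose box (k : K) : set 'rV[R]_d :=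
  [set x | forall i, `|x ord0 i - ratr (k.1 i)| < ratr k.2].
have -> : row @^-1` O = \bigcup_(k in [set: K])
    (if `[< box k `<=` O >] then row @^-1` box k else set0).
  apply/seteqP; split => t /=; last first.
    by move=> [k _]; case: asboolP => // H /H.
  move=> Ot; have /nbhs_ballP[e /= e0 He] := open_nbhs_nbhs (conj oO Ot).
  have [r] := rat_in_itvoo (divr_gt0 e0 (@ltr0Sn R 1)).
  rewrite in_itv /= => /andP[r0 re].
  have c_ i : exists q : rat, `|row t ord0 i - ratr q| < ratr r.
    have [|q] := @rat_in_itvoo R (row t ord0 i - ratr r) (row t ord0 i + ratr r).
      by rewrite ltrBlDr -addrA ltrDl addr_gt0.
    rewrite in_itv /= => /andP[q1 q2]; exists q.
    by rewrite ltr_norml; apply/andP; split; lra.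
  pose c : {ffun 'I_d -> rat} := [ffun i => xchoose (c_ i)].
  have cP i : `|row t ord0 i - ratr (c i)| < ratr r by rewrite ffunE; exact: xchooseP (c_ i).
  exists (c, r) => //; rewrite asboolT//= => x bx.
  apply: He; apply/(rV_ballP _ _ e0) => i.
  rewrite [e]splitr; apply: le_lt_trans (ler_distD (ratr (c i)) _ _) _.
  apply: ltrD; first exact: lt_trans (cP i) re.
  by rewrite distrC; exact: lt_trans (bx i) re.
apply: countable_bigcupT_measurable; first exact: countableP.
move=> k; case: ifP => _; last exact: measurable0.
rewrite (_ : row @^-1` box k = \bigcap_(i in [set: 'I_d])
    [set t | `|row t ord0 i - ratr (k.1 i)| < ratr k.2]); last first.
  by apply/seteqP; split => [t H i _|t H i]; exact: H.
apply: fin_bigcap_measurable; first exact: finite_finset.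
move=> i _; rewrite -[X in measurable X]setTI.
apply: (mrow i measurableT (Y := [set s : R | `|s - ratr (k.1 i)| < ratr k.2])).
apply: open_measurable.
rewrite (_ : [set _ | _] = ball (ratr (k.1 i) : R) (ratr k.2)); first exact: ball_open.
by apply/seteqP; split => s; rewrite /ball /= distrC.
Qed.

Lemma measurable_fun_open (O : set 'rV[R]_d) (g : 'rV[R]_d -> R) : open O ->
  (forall x, O x -> {for x, continuous g}) ->
  measurable_fun (row @^-1` O) (fun t => g (row t) : measurableTypeR R).
Proof.
move=> oO cg; apply: (measurability _ (RGenOpens.measurableE R)).
move=> _ [_ [a [b ->] <-]].
rewrite (_ : _ `&` _ = row @^-1` (O `&` g @^-1` `]a, b[%classic))//.
apply: measurable_preim_open; rewrite openE => x [Ox gx].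
apply: filterI; first exact: open_nbhs_nbhs.
apply: (cg x Ox); apply: open_nbhs_nbhs; split => //; exact: interval_open.
Qed.

Section OmegaIntegral.
Variable mu : {measure set T -> \bar R}.
Variable F : fld R d.
Hypothesis dF : diffeo_cube F.
Hypothesis finOmega : (mu (row @^-1` Omega F) < +oo)%E.
Local Notation S := (row @^-1` Omega F).

Lemma measurable_Omega : measurable S.
Proof. exact/measurable_preim_open/open_Omega. Qed.

Lemma integrable_pull0 g : pull0 F g -> mu.-integrable S (EFin \o (fun t => g (row t))).
Proof.
move=> pg; apply: measurable_bounded_integrable => //; first exact: measurable_Omega.
  apply: measurable_fun_open; first exact: open_Omega.
  by move=> x; exact: pull0_continuous.
have [M HM] := pull0_bounded pg.
exists M; split; first exact: num_real.
by move=> r Mr t St; exact: le_trans (HM _ St) (ltW Mr).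
Qed.

Lemma RintegralD_pull0 f g : pull0 F f -> pull0 F g ->
  Rintegral mu S (fun t => f (row t) + g (row t)) =
  Rintegral mu S (fun t => f (row t)) + Rintegral mu S (fun t => g (row t)).
Proof.
by move=> pf pg; rewrite RintegralD//; [exact: measurable_Omega|exact: integrable_pull0..].
Qed.

Lemma RintegralZ_pull0 c f : pull0 F f ->
  Rintegral mu S (fun t => c * f (row t)) = c * Rintegral mu S (fun t => f (row t)).
Proof.
by move=> pf; rewrite RintegralZl//; [exact: measurable_Omega|exact: integrable_pull0].
Qed.

End OmegaIntegral.
End CoordinateMeasurability.

(** * Integrals of partial derivatives along coordinate lines *)

Section Slices.
Variables (R : realType) (d : nat) (F : fld R d).
Hypothesis dF : diffeo_cube F.

Lemma pull0_coord i : pull0 F (fun x => x ord0 i).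
Proof.
exists (cmp F i) => // xi _; apply: differentiable_continuous.
by apply/differentiable_cmp/smooth_differentiable; case: dF.
Qed.

(** Each coordinate is the transport of a component of [F], hence bounded; the sum of the absolute
    bounds serves all coordinates at once. *)
Lemma Omega_bounded : exists M : R, forall x i, Omega F x -> `|x ord0 i| <= M.
Proof.
have H i := pull0_bounded (pull0_coord i).
pose m i := projT1 (cid (H i)).
exists (\sum_i `|m i|) => x i Ox; have := projT2 (cid (H i)) x Ox; rewrite -/(m i) => xm.
apply: le_trans xm _; rewrite (bigD1 i)//= (le_trans (ler_norm _))// lerDl.
by rewrite sumr_ge0.
Qed.

Lemma integral_slice g (x0 : 'rV[R]_d) j : pullv F g ->
  (\int[@lebesgue_measure R]_(t in [set t : R | Omega F (t *: delta_mx 0 j + x0)%R])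
     (pd j g (t *: delta_mx 0 j + x0)%R)%:E = 0)%E.
Proof.
move=> vg; have p1 := pullv_pull1 vg; have p0 := pull1_pd dF j p1.
have [M HM] := Omega_bounded; have [C HC] := pull0_bounded p0.
pose l (t : R) : 'rV[R]_d := t *: delta_mx 0 j + x0.
have cl : continuous l.
  move=> t; apply: (@continuousD _ _ _ (fun h : R => h *: delta_mx 0 j) (cst x0) t).
    exact: scalel_continuous.
  exact: cst_continuous.
(* On this line coordinate j equals t plus that of [x0], so a bound on [Omega F] turns into the
   bound [M + |x0 j|] on the parameter. *)
apply: (@integral_deriv_open R (l @^-1` Omega F) (g \o l) (pd j g \o l) C (M + `|x0 ord0 j|)).
- by apply: open_comp; [move=> t _; exact: cl | exact: open_Omega].
- move=> t /(HM _ j); rewrite /l !mxE !eqxx mulr1 => tM.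
  by rewrite -[t](addrK (x0 ord0 j)) (le_trans (ler_normB _ _))// lerD2r.
- move=> t Ot; split.
  + by apply: derivable_line; exact: (pull1_derivable dF).
  + apply: continuous_comp; first exact: cl.
    exact: (pull0_continuous dF p0).
  + exact: HC.
- move=> t e nOt e0; exact: (cl t _ (pullv_near dF vg nOt e0)).
Qed.

End Slices.

(** * Vanishing of a double integral from its sections *)

Section FubiniZero.
Context d1 d2 (T1 : measurableType d1) (T2 : measurableType d2) (R : realType).
Variables (m1 : {sigma_finite_measure set T1 -> \bar R})
          (m2 : {sigma_finite_measure set T2 -> \bar R}).
Variables (S : set (T1 * T2)) (f : T1 * T2 -> R).
Hypothesis (mS : measurable S) (iS : (m1 \x m2)%E.-integrable S (EFin \o f)).

(** The integrand is extended by zero to the whole product, where Fubini applies; a section of the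
    extension integrates to the integral over the section of [S]. *)
Lemma fubini_zero12 :
  (forall x, (\int[m2]_(y in [set y | S (x, y)]) (f (x, y))%:E = 0)%E) ->
  Rintegral (m1 \x m2)%E S f = 0.
Proof.
move=> H; rewrite /Rintegral integral_mkcond -integral12_prod_meas1; last by apply/(integrable_mkcond _ mS).
rewrite /fubini_F integral0_eq// => x _; rewrite -[RHS](H x) [RHS]integral_mkcond.
by apply: eq_integral => y _.
Qed.

Lemma fubini_zero21 :
  (forall y, (\int[m1]_(x in [set x | S (x, y)]) (f (x, y))%:E = 0)%E) ->
  Rintegral (m1 \x m2)%E S f = 0.
Proof.
move=> H; rewrite /Rintegral integral_mkcond -integral21_prod_meas1; last by apply/(integrable_mkcond _ mS).
rewrite /fubini_G integral0_eq// => y _; rewrite -[RHS](H y) [RHS]integral_mkcond.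
by apply: eq_integral => x _.
Qed.

End FubiniZero.

Section Rows.
Variable R : realType.
Implicit Types a b c : R.

Lemma row2_0 a b : row2 a b ord0 (i2 0) = a.
Proof. by rewrite mxE /i2 inordK. Qed.
Lemma row2_1 a b : row2 a b ord0 (i2 1) = b.
Proof. by rewrite mxE /i2 inordK. Qed.
Lemma row3_0 a b c : row3 a b c ord0 (i3 0) = a.
Proof. by rewrite mxE /i3 inordK. Qed.
Lemma row3_1 a b c : row3 a b c ord0 (i3 1) = b.
Proof. by rewrite mxE /i3 inordK. Qed.
Lemma row3_2 a b c : row3 a b c ord0 (i3 2) = c.
Proof. by rewrite mxE /i3 inordK. Qed.

Lemma ord2P (i : 'I_2) : i = i2 0 \/ i = i2 1.
Proof. by case: i => -[|[|]]// i; [left|right]; apply: val_inj; rewrite /= inordK. Qed.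

Lemma ord3P (i : 'I_3) : [\/ i = i3 0, i = i3 1 | i = i3 2].
Proof.
case: i => -[|[|[|]]]// i; [apply: Or31|apply: Or32|apply: Or33];
  by apply: val_inj; rewrite /= inordK.
Qed.

(** Puts a coordinate line into the affine form on which [integral_slice] is stated. *)
Lemma row2_line0 a b : row2 a b = a *: delta_mx 0 (i2 0) + row2 0 b.
Proof.
by apply/rowP => i; rewrite 2!mxE; case: (ord2P i) => ->;
  rewrite ?row2_0 ?row2_1 !mxE !eqxx /= -?val_eqE /= !inordK//= ?(mulr1, mulr0, addr0, add0r).
Qed.

Lemma row2_line1 a b : row2 a b = b *: delta_mx 0 (i2 1) + row2 a 0.
Proof.
by apply/rowP => i; rewrite 2!mxE; case: (ord2P i) => ->;
  rewrite ?row2_0 ?row2_1 !mxE !eqxx /= -?val_eqE /= !inordK//= ?(mulr1, mulr0, addr0, add0r).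
Qed.

Lemma row3_line0 a b c : row3 a b c = a *: delta_mx 0 (i3 0) + row3 0 b c.
Proof.
by apply/rowP => i; rewrite 2!mxE; case: (ord3P i) => ->;
  rewrite !mxE !eqxx /= -?val_eqE /= !inordK//= ?(mulr1, mulr0, addr0, add0r).
Qed.

Lemma row3_line1 a b c : row3 a b c = b *: delta_mx 0 (i3 1) + row3 a 0 c.
Proof.
by apply/rowP => i; rewrite 2!mxE; case: (ord3P i) => ->;
  rewrite !mxE !eqxx /= -?val_eqE /= !inordK//= ?(mulr1, mulr0, addr0, add0r).
Qed.

Lemma row3_line2 a b c : row3 a b c = c *: delta_mx 0 (i3 2) + row3 a b 0.
Proof.
by apply/rowP => i; rewrite 2!mxE; case: (ord3P i) => ->;
  rewrite !mxE !eqxx /= -?val_eqE /= !inordK//= ?(mulr1, mulr0, addr0, add0r).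
Qed.

End Rows.

(** * Integration over two- and three-dimensional domains *)

Section VolumeIntegrals.
Variable R : realType.
Notation Rm := (measurableTypeR R).
Notation mu1 := (@lebesgue_measure R).
Notation mu2 := (@lebesgue_measure R \x @lebesgue_measure R)%E.
Notation mu3 := ((@lebesgue_measure R \x @lebesgue_measure R) \x @lebesgue_measure R)%E.

Let mrow2 i : measurable_fun [set: Rm * Rm] (fun p => row2 p.1 p.2 ord0 i : Rm).
Proof.
case: (ord2P i) => ->.
  by under eq_fun do rewrite row2_0; exact: measurable_fst.
by under eq_fun do rewrite row2_1; exact: measurable_snd.
Qed.

Let mrow3 i : measurable_fun [set: Rm * Rm * Rm] (fun p => row3 p.1.1 p.1.2 p.2 ord0 i : Rm).
Proof.
case: (ord3P i) => ->.
- under eq_fun do rewrite row3_0.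
  exact: (measurableT_comp measurable_fst measurable_fst).
- under eq_fun do rewrite row3_1.
  exact: (measurableT_comp measurable_snd measurable_fst).
- by under eq_fun do rewrite row3_2; exact: measurable_snd.
Qed.

(** The plane at height [z], seen as a map into the three-dimensional space: horizontal sections of
    [Omega F] then fall under the same measurability and integrability lemmas. *)
Let mrow3z (z : R) i : measurable_fun [set: Rm * Rm] (fun p => row3 p.1 p.2 z ord0 i : Rm).
Proof.
case: (ord3P i) => ->.
- by under eq_fun do rewrite row3_0; exact: measurable_fst.
- by under eq_fun do rewrite row3_1; exact: measurable_snd.
- by under eq_fun do rewrite row3_2; exact: measurable_cst.
Qed.

Let box (M : R) : set Rm := `[- M, M]%classic.

Let mbox M : measurable (box M). Proof. exact: measurable_itv. Qed.

Let box_fin M : (mu1 (box M) < +oo)%E.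
Proof. by rewrite lebesgue_measure_itv /=; case: ifP => _; rewrite -?EFinB ltry. Qed.

Let mu2_fin (S : set (Rm * Rm)) M : measurable S ->
  (forall p, S p -> `|p.1| <= M /\ `|p.2| <= M) -> (mu2 S < +oo)%E.
Proof.
move=> mS SM; apply: (@le_lt_trans _ _ (mu2 (box M `*` box M))).
  apply: le_measure; rewrite ?inE//; first by apply: measurableX; exact: mbox.
  by move=> p /SM [p1 p2]; split; rewrite /box /= in_itv /= -ler_norml.
have bM := box_fin M.
by rewrite product_measure1E; [|exact: mbox..]; apply: lte_mul_pinfty => //; rewrite ge0_fin_numE.
Qed.

(* The canonical sigma-finite structure on a product measure is only found by
   inference when both factors are sub-probabilities. *)
Let mu2_sigma_finite : sigma_finite setT mu2.
Proof.
exists (fun n => box n%:R `*` box n%:R).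
  rewrite predeqE => -[x y]; split=> // _.
  exists (Num.bound `|x| + Num.bound `|y|)%N => //; rewrite /box.
  have bx : `|x| <= (Num.bound `|x|)%:R by rewrite ltW// archi_boundP.
  have by_ : `|y| <= (Num.bound `|y|)%:R by rewrite ltW// archi_boundP.
  by split; rewrite /= in_itv /= -ler_norml natrD;
    [apply: le_trans bx _; rewrite lerDl|apply: le_trans by_ _; rewrite lerDr].
move=> n; split; first by apply: measurableX; exact: mbox.
have bM := box_fin n%:R.
by rewrite product_measure1E; [|exact: mbox..]; apply: lte_mul_pinfty => //; rewrite ge0_fin_numE.
Qed.

Let mu2s : {sigma_finite_measure set (Rm * Rm)%type -> \bar R} :=
  HB.pack mu2 (Measure_isSigmaFinite.Build _ _ _ mu2 mu2_sigma_finite).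

Let mu3_fin (S : set (Rm * Rm * Rm)) M : measurable S ->
  (forall p, S p -> [/\ `|p.1.1| <= M, `|p.1.2| <= M & `|p.2| <= M]) -> (mu3 S < +oo)%E.
Proof.
move=> mS SM; apply: (@le_lt_trans _ _ (mu3 ((box M `*` box M) `*` box M))).
  apply: le_measure; rewrite ?inE//; first by do 2 ?apply: measurableX; exact: mbox.
  by move=> p /SM [p1 p2 p3]; do ?split; rewrite /box /= in_itv /= -ler_norml.
have bM := box_fin M.
have fb : (mu2 (box M `*` box M) < +oo)%E.
  by rewrite product_measure1E; [|exact: mbox..]; apply: lte_mul_pinfty => //; rewrite ge0_fin_numE.
rewrite product_measure1E; [|by apply: measurableX; exact: mbox|exact: mbox].
by apply: lte_mul_pinfty => //; rewrite ge0_fin_numE.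
Qed.

Section Dim2.
Variable F : fld R 2.
Hypothesis dF : diffeo_cube F.
Let row (p : Rm * Rm) := row2 p.1 p.2.

Let fin2 : (mu2 (row @^-1` Omega F) < +oo)%E.
Proof.
have [M HM] := Omega_bounded dF.
apply: (@mu2_fin _ M); first exact: (measurable_Omega mrow2 dF).
move=> p Op; split; first by have := HM _ (i2 0) Op; rewrite /row row2_0.
by have := HM _ (i2 1) Op; rewrite /row row2_1.
Qed.

Lemma volint2D f g : pull0 F f -> pull0 F g ->
  volint2 (Omega F) (fun x => f x + g x) = volint2 (Omega F) f + volint2 (Omega F) g.
Proof. exact: (RintegralD_pull0 mrow2 dF fin2). Qed.

Lemma volint2Z c f : pull0 F f -> volint2 (Omega F) (fun x => c * f x) = c * volint2 (Omega F) f.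
Proof. exact: (RintegralZ_pull0 mrow2 dF fin2). Qed.

(** The order of integration is chosen so that the inner integral runs in the direction of
    differentiation. *)
Lemma volint2_pd g j : pullv F g -> volint2 (Omega F) (pd j g) = 0.
Proof.
move=> vg; have p0 := pull1_pd dF j (pullv_pull1 vg).
have i0 := integrable_pull0 mrow2 dF fin2 p0.
have mS := measurable_Omega mrow2 dF.
case: (ord2P j) => ej.
  apply: (fubini_zero21 mS i0) => y; rewrite -[RHS](integral_slice dF (row2 0 y) j vg).
  rewrite ej; under eq_integral do rewrite /row /= row2_line0.
  by congr integral; apply/funext => x; rewrite /row /= -row2_line0.
apply: (fubini_zero12 mS i0) => x; rewrite -[RHS](integral_slice dF (row2 x 0) j vg).
rewrite ej; under eq_integral do rewrite /row /= row2_line1.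
by congr integral; apply/funext => y; rewrite /row /= -row2_line1.
Qed.

End Dim2.

Section Dim3.
Variable F : fld R 3.
Hypothesis dF : diffeo_cube F.
Let row (p : Rm * Rm * Rm) := row3 p.1.1 p.1.2 p.2.

Let fin3 : (mu3 (row @^-1` Omega F) < +oo)%E.
Proof.
have [M HM] := Omega_bounded dF.
apply: (@mu3_fin _ M); first exact: (measurable_Omega mrow3 dF).
move=> p Op; split.
- by have := HM _ (i3 0) Op; rewrite /row row3_0.
- by have := HM _ (i3 1) Op; rewrite /row row3_1.
- by have := HM _ (i3 2) Op; rewrite /row row3_2.
Qed.

Lemma volint3D f g : pull0 F f -> pull0 F g ->
  volint3 (Omega F) (fun x => f x + g x) = volint3 (Omega F) f + volint3 (Omega F) g.
Proof. exact: (RintegralD_pull0 mrow3 dF fin3). Qed.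

Lemma volint3Z c f : pull0 F f -> volint3 (Omega F) (fun x => c * f x) = c * volint3 (Omega F) f.
Proof. exact: (RintegralZ_pull0 mrow3 dF fin3). Qed.

Lemma volint3_pd g j : pullv F g -> volint3 (Omega F) (pd j g) = 0.
Proof.
move=> vg; have p0 := pull1_pd dF j (pullv_pull1 vg).
have i0 := integrable_pull0 mrow3 dF fin3 p0.
have mS := measurable_Omega mrow3 dF.
have finz z : (mu2 ((fun p : Rm * Rm => row3 p.1 p.2 z) @^-1` Omega F) < +oo)%E.
  have [M HM] := Omega_bounded dF.
  apply: (@mu2_fin _ M); first exact: (measurable_Omega (mrow3z z) dF).
  move=> p Op; split; first by have := HM _ (i3 0) Op; rewrite row3_0.
  by have := HM _ (i3 1) Op; rewrite row3_1.
(* For the first two directions the height is integrated last and a planar Fubini argument settles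
   each section; for the third direction the height is the inner variable and one application
   suffices. *)
have slab : (forall z, Rintegral mu2 [set p : Rm * Rm | Omega F (row3 p.1 p.2 z)]
    (fun p => pd j g (row3 p.1 p.2 z)) = 0) -> volint3 (Omega F) (pd j g) = 0.
  move=> H.
  have f21 := @fubini_zero21 _ _ (Rm * Rm)%type Rm R
    mu2s mu1
    (row @^-1` Omega F) (fun t => pd j g (row t)) mS i0.
  have E : volint3 (Omega F) (pd j g) =
    Rintegral mu3 (row @^-1` Omega F) (fun t => pd j g (row t)) by [].
  rewrite E; apply: f21 => z.
  have iz := integrable_pull0 (mrow3z z) dF (finz z) p0.
  have mz := measurable_Omega (mrow3z z) dF.
  rewrite -[LHS]fineK; last exact: integrable_fin_num iz.
  by congr (_%:E); exact: (H z).
case: (ord3P j) => ej.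
- apply: slab => z.
  apply: (fubini_zero21 (measurable_Omega (mrow3z z) dF)
           (integrable_pull0 (mrow3z z) dF (finz z) p0)) => y.
  rewrite -[RHS](integral_slice dF (row3 0 y z) j vg).
  rewrite ej; under eq_integral do rewrite /= row3_line0.
  by congr integral; apply/funext => x; rewrite /= -row3_line0.
- apply: slab => z.
  apply: (fubini_zero12 (measurable_Omega (mrow3z z) dF)
           (integrable_pull0 (mrow3z z) dF (finz z) p0)) => x.
  rewrite -[RHS](integral_slice dF (row3 x 0 z) j vg).
  rewrite ej; under eq_integral do rewrite /= row3_line1.
  by congr integral; apply/funext => y; rewrite /= -row3_line1.
- have f12 := @fubini_zero12 _ _ (Rm * Rm)%type Rm R
    mu2s mu1
    (row @^-1` Omega F) (fun t => pd j g (row t)) mS i0.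
  have E : volint3 (Omega F) (pd j g) =
    Rintegral mu3 (row @^-1` Omega F) (fun t => pd j g (row t)) by [].
  rewrite E; apply: f12 => p; rewrite -[RHS](integral_slice dF (row3 p.1 p.2 0) j vg).
  rewrite ej; under eq_integral do rewrite /row /= row3_line2.
  by congr integral; apply/funext => z; rewrite /row /= -row3_line2.
Qed.

End Dim3.

Section Dim23.
Variables (d : nat) (F : fld R d).
Hypotheses (d23 : (d = 2 \/ d = 3)%N) (dF : diffeo_cube F).

Lemma volintD f g : pull0 F f -> pull0 F g ->
  volint (Omega F) (fun x => f x + g x) = volint (Omega F) f + volint (Omega F) g.
Proof.
by move: F dF f g; case: d23 => -> G dG f g; [exact: volint2D | exact: volint3D].
Qed.

Lemma volintZ c f : pull0 F f ->
  volint (Omega F) (fun x => c * f x) = c * volint (Omega F) f.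
Proof.
by move: F dF f; case: d23 => -> G dG f; [exact: volint2Z | exact: volint3Z].
Qed.

Lemma volint_pd g j : pullv F g -> volint (Omega F) (pd j g) = 0.
Proof.
by move: F dF g j; case: d23 => -> G dG g j; [exact: volint2_pd | exact: volint3_pd].
Qed.

Lemma eq_volint (f g : 'rV[R]_d -> R) : (forall x, Omega F x -> f x = g x) ->
  volint (Omega F) f = volint (Omega F) g.
Proof.
by move: F f g; case: d23 => -> G f g fg; apply: eq_Rintegral => p /[1!inE] Op; exact: fg.
Qed.

Lemma volint0 : volint (Omega F) (fun=> 0) = 0.
Proof.
rewrite -[RHS](mul0r (volint (Omega F) (fun=> 0))) -(volintZ 0 (pull0_cst F 0)).
by apply: eq_volint => x _; rewrite mul0r.
Qed.

Lemma volint_sum (I : Type) (r : seq I) (f : I -> 'rV[R]_d -> R) :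
  (forall a, pull0 F (f a)) ->
  volint (Omega F) (fun x => \sum_(a <- r) f a x) = \sum_(a <- r) volint (Omega F) (f a).
Proof.
move=> H; elim: r => [|a r IH].
  by rewrite big_nil -[RHS]volint0; apply: eq_volint => x _; rewrite big_nil.
rewrite big_cons -IH -volintD//; last exact: pull0_sum.
by apply: eq_volint => x _; rewrite big_cons.
Qed.

End Dim23.
End VolumeIntegrals.

(** * Reference spaces *)

Section ReferenceSpaces.
Variable R : realType.

Section Closure.
Variables (d : nat).

Definition C1fld (P : fld R d) := forall i, C1on setT (cmp P i).

Definition div (P : fld R d) x := \sum_i pd i (cmp P i) x.

Definition div_free0 (P : fld R d) := [/\ C1fld P, forall xi, div P xi = 0 &
  forall xi, cube_cl xi -> ~ cube_open xi -> P xi = 0].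

Lemma C1fldD P Q : C1fld P -> C1fld Q -> C1fld (fun xi => P xi + Q xi).
Proof.
move=> cP cQ i; apply: eq_C1on (C1onD openT (cP i) (cQ i)) => x.
by rewrite /cmp mxE.
Qed.

Lemma C1fldZ a P : C1fld P -> C1fld (fun xi => a *: P xi).
Proof.
move=> cP i; apply: eq_C1on (C1onM openT (C1on_cst (D := setT) a) (cP i)) => x.
by rewrite /cmp mxE.
Qed.

Lemma C1fld0 : C1fld (fun=> 0).
Proof. by move=> i; apply: eq_C1on (C1on_cst (D := setT) 0) => x; rewrite /cmp mxE. Qed.

Lemma div_free0D P Q : div_free0 P -> div_free0 Q -> div_free0 (fun xi => P xi + Q xi).
Proof.
move=> [cP dP bP] [cQ dQ bQ]; split; first exact: C1fldD.
  move=> xi; rewrite -[RHS](addr0 0) -{1}(dP xi) -(dQ xi) /div -big_split /=.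
  apply: eq_bigr => i _; rewrite -(pdD i (cP i xi I).1 (cQ i xi I).1).
  by congr (pd i _ xi); apply/funext => x; rewrite /cmp mxE.
by move=> xi cxi nxi; rewrite bP// bQ// addr0.
Qed.

Lemma div_free0Z a P : div_free0 P -> div_free0 (fun xi => a *: P xi).
Proof.
move=> [cP dP bP]; split; first exact: C1fldZ.
  move=> xi; rewrite -[RHS](mulr0 a) -(dP xi) /div mulr_sumr.
  apply: eq_bigr => i _; have := pdM i (differentiable_cst a xi) (cP i xi I).1.
  rewrite pd_cst mulr0 addr0 => <-.
  by congr (pd i _ xi); apply/funext => x; rewrite /cmp mxE.
by move=> xi cxi nxi; rewrite bP// scaler0.
Qed.

Lemma div_free00 : div_free0 (fun=> 0).
Proof.
split=> //; first exact: C1fld0.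
move=> xi; rewrite /div big1// => i _.
rewrite (_ : cmp _ i = fun=> 0) ?pd_cst//.
by apply/funext => x; rewrite /cmp mxE.
Qed.

(** Membership of the index is kept in the hypothesis because [vphi_deriv] holds for positive
    indices only. *)
Lemma closed_sum (Q : fld R d -> Prop) (I : eqType) (r : seq I) (f : I -> fld R d) :
  Q (fun=> 0) -> (forall f g, Q f -> Q g -> Q (fun x => f x + g x)) ->
  (forall a, a \in r -> Q (f a)) -> Q (fun x => \sum_(a <- r) f a x).
Proof.
move=> Q0 QD; elim: r => [|a r IH] H.
  by rewrite (_ : (fun _ => _) = fun=> 0)//; apply/funext => x; rewrite big_nil.
rewrite (_ : (fun _ => _) = fun x => f a x + \sum_(a <- r) f a x).
  apply: QD; first by apply: H; rewrite mem_head.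
  by apply: IH => b br; apply: H; rewrite inE br orbT.
by apply/funext => x; rewrite big_cons.
Qed.

Lemma closed_sum_nat (Q : fld R d -> Prop) m n (f : nat -> fld R d) :
  Q (fun=> 0) -> (forall f g, Q f -> Q g -> Q (fun x => f x + g x)) ->
  (forall a, (m <= a < n)%N -> Q (f a)) -> Q (fun x => \sum_(m <= a < n) f a x).
Proof. by move=> Q0 QD H; apply: closed_sum => // a; rewrite mem_index_iota; exact: H. Qed.

(** The square treats opposite faces together and is the form in which [psi_pm1] and [vphi_pm1] are
    stated. *)
Lemma cubeP (xi : 'rV[R]_d) : cube_cl xi -> ~ cube_open xi -> exists i, xi ord0 i ^+ 2 = 1.
Proof.
move=> cxi nxi; apply: contrapT => H; apply: nxi => i.
have /andP[l u] := cxi i; rewrite !lt_neqAle l u !andbT.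
apply/andP; split; apply/eqP => e; apply: H; exists i.
  by rewrite -e sqrrN expr1n.
by rewrite e expr1n.
Qed.

End Closure.

Definition polyfun (f : R -> R) := exists p : {poly R}, f = horner p.

Lemma C1on_polyfun d f (i : 'I_d) : polyfun f -> C1on setT (fun x : 'rV[R]_d => f (x ord0 i)).
Proof. by move=> [p ->]; exact: C1on_horner_coord. Qed.

Lemma vphi_psi_poly m : (0 < m)%N ->
  exists p : {poly R}, vphi (m + 3) = horner p /\ psi (m + 2) = horner (deriv p).
Proof.
move=> m0; have [p Ep] := vphiP R (m + 3); exists p; split=> //.
apply/funext => x; have [_ <-] := vphi_deriv x m0.
by rewrite Ep derivE derive1E.
Qed.

Lemma pd_mul2 (p q : {poly R}) (x : 'rV[R]_2) j :
  pd j (fun x : 'rV[R]_2 => p.[x ord0 (i2 0)] * q.[x ord0 (i2 1)]) x =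
  (i2 0 == j)%:R * ((deriv p).[x ord0 (i2 0)] * q.[x ord0 (i2 1)]) +
  (i2 1 == j)%:R * (p.[x ord0 (i2 0)] * (deriv q).[x ord0 (i2 1)]).
Proof.
have [dp Ep] := diff_horner_coord p (i2 0) x; have [dq Eq] := diff_horner_coord q (i2 1) x.
rewrite (pdM j dp dq) Ep Eq.
by move: (i2 0 == j)%:R (i2 1 == j)%:R => a b; ring.
Qed.

Lemma pd_mul3 (p q r : {poly R}) (x : 'rV[R]_3) j :
  pd j (fun x : 'rV[R]_3 => p.[x ord0 (i3 0)] * q.[x ord0 (i3 1)] * r.[x ord0 (i3 2)]) x =
  (i3 0 == j)%:R * ((deriv p).[x ord0 (i3 0)] * q.[x ord0 (i3 1)] * r.[x ord0 (i3 2)]) +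
  (i3 1 == j)%:R * (p.[x ord0 (i3 0)] * (deriv q).[x ord0 (i3 1)] * r.[x ord0 (i3 2)]) +
  (i3 2 == j)%:R * (p.[x ord0 (i3 0)] * q.[x ord0 (i3 1)] * (deriv r).[x ord0 (i3 2)]).
Proof.
have [dp Ep] := diff_horner_coord p (i3 0) x; have [dq Eq] := diff_horner_coord q (i3 1) x.
have [dr Er] := diff_horner_coord r (i3 2) x.
have dpq : differentiable (fun x : 'rV[R]_3 => p.[x ord0 (i3 0)] * q.[x ord0 (i3 1)]) x.
  exact: differentiableM.
rewrite (pdM j dpq dr) (pdM j dp dq) Ep Eq Er.
by move: (i3 0 == j)%:R (i3 1 == j)%:R (i3 2 == j)%:R => a b c; ring.
Qed.

Lemma sum2E (V : nmodType) (f : 'I_2 -> V) : \sum_i f i = f (i2 0) + f (i2 1).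
Proof.
by rewrite !big_ord_recl big_ord0 addr0; congr (f _ + f _); apply: val_inj; rewrite /= inordK.
Qed.

Lemma sum3E (V : nmodType) (f : 'I_3 -> V) : \sum_i f i = f (i3 0) + f (i3 1) + f (i3 2).
Proof.
rewrite !big_ord_recl big_ord0 addr0 addrA.
by congr (f _ + f _ + f _); apply: val_inj; rewrite /= inordK.
Qed.

Lemma pd_opp d (f : 'rV[R]_d -> R) j x : differentiable f x ->
  pd j (fun x => - f x) x = - pd j f x.
Proof.
move=> df; have := pdM j (differentiable_cst (-1 : R) x) df.
rewrite pd_cst mulr0 addr0 mulN1r => <-.
by congr (pd j _ x); apply/funext => y; rewrite mulN1r.
Qed.

(** The field is the curl of the stream function p(x_1) q(x_2), which vanishes together with its
    gradient on the boundary of the square. *)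
Lemma div_free0_pair2 (p q : {poly R}) :
  (forall e : R, e ^+ 2 = 1 -> [/\ p.[e] = 0, q.[e] = 0, (deriv p).[e] = 0 & (deriv q).[e] = 0]) ->
  div_free0 (fun x : 'rV[R]_2 => row2 (p.[x ord0 (i2 0)] * (deriv q).[x ord0 (i2 1)])
    (- ((deriv p).[x ord0 (i2 0)] * q.[x ord0 (i2 1)]))).
Proof.
move=> z; set P := fun x => _.
have E0 : cmp P (i2 0) = fun x => p.[x ord0 (i2 0)] * (deriv q).[x ord0 (i2 1)].
  by apply/funext => x; rewrite /cmp row2_0.
have E1 : cmp P (i2 1) = fun x => - ((deriv p).[x ord0 (i2 0)] * q.[x ord0 (i2 1)]).
  by apply/funext => x; rewrite /cmp row2_1.
have C (a b : {poly R}) : C1on setT (fun x : 'rV[R]_2 => a.[x ord0 (i2 0)] * b.[x ord0 (i2 1)]).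
  by apply: (C1onM openT); exact: C1on_horner_coord.
have n01 : (i2 0 == i2 1) = false by rewrite -val_eqE /= !inordK.
have n10 : (i2 1 == i2 0) = false by rewrite -val_eqE /= !inordK.
split.
- by move=> i; case: (ord2P i) => ->; rewrite ?E0 ?E1; [exact: C|exact/(C1onN openT)/C].
- move=> xi; rewrite /div sum2E E0 E1 pd_opp; last by have [] := C (deriv p) q xi I.
  by rewrite !pd_mul2 !eqxx n01 n10 /=; ring.
- move=> xi cxi nxi; have [i /z[p0 q0 p1 q1]] := cubeP cxi nxi.
  apply/rowP => j; rewrite [RHS]mxE /P.
  by case: (ord2P i) p0 q0 p1 q1 => -> p0 q0 p1 q1; case: (ord2P j) => ->;
    rewrite ?row2_0 ?row2_1 ?p0 ?q0 ?p1 ?q1 ?(mul0r, mulr0, oppr0).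
Qed.

Definition sep3 (p q r : {poly R}) (x : 'rV[R]_3) :=
  p.[x ord0 (i3 0)] * q.[x ord0 (i3 1)] * r.[x ord0 (i3 2)].

Lemma C1on_sep3 p q r : C1on setT (sep3 p q r).
Proof. by do 2 ?apply: (C1onM openT); exact: C1on_horner_coord. Qed.

Lemma div_free0_sep3 (p0 q0 r0 p1 q1 r1 p2 q2 r2 : {poly R}) :
  (forall x, sep3 (deriv p0) q0 r0 x + sep3 p1 (deriv q1) r1 x + sep3 p2 q2 (deriv r2) x = 0) ->
  (forall e : R, e ^+ 2 = 1 -> [/\ [/\ p0.[e] = 0, q0.[e] = 0 & r0.[e] = 0],
     [/\ p1.[e] = 0, q1.[e] = 0 & r1.[e] = 0] & [/\ p2.[e] = 0, q2.[e] = 0 & r2.[e] = 0]]) ->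
  div_free0 (fun x => row3 (sep3 p0 q0 r0 x) (sep3 p1 q1 r1 x) (sep3 p2 q2 r2 x)).
Proof.
move=> dz z; set P := fun x => _.
have E0 : cmp P (i3 0) = sep3 p0 q0 r0 by apply/funext => x; rewrite /cmp row3_0.
have E1 : cmp P (i3 1) = sep3 p1 q1 r1 by apply/funext => x; rewrite /cmp row3_1.
have E2 : cmp P (i3 2) = sep3 p2 q2 r2 by apply/funext => x; rewrite /cmp row3_2.
have n a b : (a < 3)%N -> (b < 3)%N -> (i3 a == i3 b) = (a == b).
  by move=> a3 b3; rewrite -val_eqE /= !inordK.
split.
- by move=> i; case: (ord3P i) => ->; rewrite ?E0 ?E1 ?E2; exact: C1on_sep3.
- by move=> xi; rewrite /div sum3E E0 E1 E2 !pd_mul3 !n//= -[RHS](dz xi) /sep3 !mul0r !mul1r !addr0 !add0r.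
- move=> xi cxi nxi; have [i /z[[a0 b0 c0] [a1 b1 c1] [a2 b2 c2]]] := cubeP cxi nxi.
  apply/rowP => j; rewrite [RHS]mxE /P.
  case: (ord3P j) => ->; rewrite ?row3_0 ?row3_1 ?row3_2 /sep3;
  case: (ord3P i) a0 b0 c0 a1 b1 c1 a2 b2 c2 => -> a0 b0 c0 a1 b1 c1 a2 b2 c2;
    by rewrite ?a0 ?b0 ?c0 ?a1 ?b1 ?c1 ?a2 ?b2 ?c2 ?(mul0r, mulr0).
Qed.

(** Each of the five spatial families is the curl of a stream function in two of the variables,
    multiplied by a [psi] of the third. Two terms of the divergence cancel, and every factor in
    sight vanishes at both end points. *)
Lemma refU_div_free0 (d N : nat) (P : fld R d) : refU N P -> div_free0 P.
Proof.
have zv m (e : R) : e ^+ 2 = 1 -> vphi m e = 0 by exact: vphi_pm1.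
have zp m (e : R) : e ^+ 2 = 1 -> psi m e = 0 by exact: psi_pm1.
case: d P => [|[|[|[|d]]]]// P [c Pc].
  rewrite (funext Pc).
  apply: closed_sum_nat; [exact: div_free00|exact: div_free0D|move=> m /andP[m0 _]].
  apply: closed_sum_nat; [exact: div_free00|exact: div_free0D|move=> n /andP[n0 _]].
  apply: div_free0Z; rewrite /uref2.
  have [p [vp sp]] := vphi_psi_poly m0; have [q [vq sq]] := vphi_psi_poly n0.
  rewrite vp sp vq sq; apply: div_free0_pair2 => e e1.
  by rewrite -vp -sp -vq -sq; split; [exact: zv|exact: zv|exact: zp|exact: zp].
rewrite (funext Pc).
apply: closed_sum; [exact: div_free00|exact: div_free0D|move=> t _].
apply: closed_sum_nat; [exact: div_free00|exact: div_free0D|move=> m /andP[m0 _]].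
apply: closed_sum_nat; [exact: div_free00|exact: div_free0D|move=> n /andP[n0 _]].
apply: closed_sum_nat; [exact: div_free00|exact: div_free0D|move=> l /andP[l0 _]].
apply: div_free0Z.
have [p [vp sp]] := vphi_psi_poly m0; have [q [vq sq]] := vphi_psi_poly n0.
have [r [vr sr]] := vphi_psi_poly l0; have [s ss] := psiP R 2.
have zall e : e ^+ 2 = 1 -> [/\ p.[e] = 0, q.[e] = 0, r.[e] = 0, s.[e] = 0 &
    [/\ (deriv p).[e] = 0, (deriv q).[e] = 0 & (deriv r).[e] = 0]].
  by move=> e1; rewrite -vp -vq -vr -sp -sq -sr -ss; split;
    [exact: zv|exact: zv|exact: zv|exact: zp|split; exact: zp].
have K (p0 q0 r0 p1 q1 r1 p2 q2 r2 : {poly R}) (g : fld R 3) :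
    (forall x, g x = row3 (sep3 p0 q0 r0 x) (sep3 p1 q1 r1 x) (sep3 p2 q2 r2 x)) ->
    (forall x, sep3 (deriv p0) q0 r0 x + sep3 p1 (deriv q1) r1 x + sep3 p2 q2 (deriv r2) x = 0) ->
    (forall e : R, e ^+ 2 = 1 -> [/\ [/\ p0.[e] = 0, q0.[e] = 0 & r0.[e] = 0],
       [/\ p1.[e] = 0, q1.[e] = 0 & r1.[e] = 0] & [/\ p2.[e] = 0, q2.[e] = 0 & r2.[e] = 0]]) ->
    div_free0 g.
  by move=> /funext -> dz z; exact: div_free0_sep3.
case: t => -[|[|[|[|t]]]] ti; rewrite /uref3 /= ?vp ?sp ?vq ?sq ?vr ?sr ?ss.
- apply: (K p (deriv q) (deriv r) (- deriv p) q (deriv r) 0 0 0) => [x|x|e /zall[a1 a2 a3 a4 [a5 a6 a7]]].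
  + by rewrite /sep3 ?hornerN ?horner0 ?mulNr ?mul0r.
  + by rewrite /sep3 ?deriv0 ?hornerN ?horner0; ring.
  + by rewrite ?hornerN ?horner0 ?a1 ?a2 ?a3 ?a4 ?a5 ?a6 ?a7 ?oppr0.
- apply: (K p (deriv q) (deriv r) 0 0 0 (- deriv p) (deriv q) r) => [x|x|e /zall[a1 a2 a3 a4 [a5 a6 a7]]].
  + by rewrite /sep3 ?hornerN ?horner0 ?mulNr ?mul0r.
  + by rewrite /sep3 ?deriv0 ?hornerN ?horner0; ring.
  + by rewrite ?hornerN ?horner0 ?a1 ?a2 ?a3 ?a4 ?a5 ?a6 ?a7 ?oppr0.
- apply: (K 0 0 0 s q (deriv r) (- s) (deriv q) r) => [x|x|e /zall[a1 a2 a3 a4 [a5 a6 a7]]].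
  + by rewrite /sep3 ?hornerN ?horner0 ?mulNr ?mul0r.
  + by rewrite /sep3 ?deriv0 ?hornerN ?horner0; ring.
  + by rewrite ?hornerN ?horner0 ?a1 ?a2 ?a3 ?a4 ?a5 ?a6 ?a7 ?oppr0.
- apply: (K p s (deriv r) 0 0 0 (- deriv p) s r) => [x|x|e /zall[a1 a2 a3 a4 [a5 a6 a7]]].
  + by rewrite /sep3 ?hornerN ?horner0 ?mulNr ?mul0r.
  + by rewrite /sep3 ?deriv0 ?hornerN ?horner0; ring.
  + by rewrite ?hornerN ?horner0 ?a1 ?a2 ?a3 ?a4 ?a5 ?a6 ?a7 ?oppr0.
- apply: (K p (deriv q) s (- deriv p) q s 0 0 0) => [x|x|e /zall[a1 a2 a3 a4 [a5 a6 a7]]].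
  + by rewrite /sep3 ?hornerN ?horner0 ?mulNr ?mul0r.
  + by rewrite /sep3 ?deriv0 ?hornerN ?horner0; ring.
  + by rewrite ?hornerN ?horner0 ?a1 ?a2 ?a3 ?a4 ?a5 ?a6 ?a7 ?oppr0.
Qed.

Lemma refW_C1 (d N : nat) (P : fld R d) : refW N P -> C1fld P.
Proof.
case: d P => [|[|[|[|d]]]]// P [c Pc].
  rewrite (funext Pc).
  apply: closed_sum_nat; [exact: C1fld0|exact: C1fldD|move=> m _].
  apply: closed_sum_nat; [exact: C1fld0|exact: C1fldD|move=> n _].
  apply: C1fldZ => i.
  have C f g : polyfun f -> polyfun g ->
      C1on setT (fun x : 'rV[R]_2 => f (x ord0 (i2 0)) * g (x ord0 (i2 1))).
    by move=> pf pg; apply: (C1onM openT); exact: C1on_polyfun.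
  case: (ord2P i) => ->.
    by apply: eq_C1on (C _ _ (psiP R m.+1) (phiP R n)) => x; rewrite /cmp row2_0.
  by apply: eq_C1on (C1onN openT (C _ _ (phiP R m) (psiP R n.+1))) => x; rewrite /cmp row2_1.
rewrite (funext Pc).
apply: closed_sum; [exact: C1fld0|exact: C1fldD|move=> t _].
apply: closed_sum_nat; [exact: C1fld0|exact: C1fldD|move=> m _].
apply: closed_sum_nat; [exact: C1fld0|exact: C1fldD|move=> n _].
apply: closed_sum_nat; [exact: C1fld0|exact: C1fldD|move=> l _].
apply: C1fldZ => i.
have C f (k : 'I_3) : polyfun f -> C1on setT (fun x : 'rV[R]_3 => f (x ord0 k)).
  exact: C1on_polyfun.
have row3C a b c0 : C1on setT a -> C1on setT b -> C1on setT c0 ->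
    C1on setT (cmp (fun x : 'rV[R]_3 => row3 (a x) (b x) (c0 x)) i).
  by move=> ha hb hc; case: (ord3P i) => ->; [apply: eq_C1on ha|apply: eq_C1on hb|apply: eq_C1on hc]
    => x; rewrite /cmp ?row3_0 ?row3_1 ?row3_2.
have ps k : polyfun (psi k) := psiP R k.
have ph k : polyfun (phi k) := phiP R k.
have Cs k a : C1on setT (fun x : 'rV[R]_3 => psi k (x ord0 a)) := C _ a (ps k).
have Ch k a : C1on setT (fun x : 'rV[R]_3 => phi k (x ord0 a)) := C _ a (ph k).
case: t => -[|[|[|[|t]]]] ti /=; apply: row3C => /=;
  repeat first [exact: C1on_cst | exact: Cs | exact: Ch | apply: (C1onN openT) | apply: (C1onM openT)].
Qed.

End ReferenceSpaces.

(** * Energy identities *)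

Section EnergyIdentities.
Variables (R : realType) (d : nat) (F : fld R d).
Hypotheses (d23 : (d = 2 \/ d = 3)%N) (dF : diffeo_cube F).
Implicit Types (u v w B : fld R d).

Lemma eq_pullv (f g : 'rV[R]_d -> R) : f =1 g -> pullv F f -> pullv F g.
Proof. by move=> /funext ->. Qed.

Lemma eq_pull1 (f g : 'rV[R]_d -> R) : f =1 g -> pull1 F f -> pull1 F g.
Proof. by move=> /funext ->. Qed.

(** The Piola formula as a function of the reference variable, meaningful beyond the cube; it is the
    witness for [pull1] and [pullv]. *)
Let h (P : fld R d) i xi := (\det (jac F xi))^-1 * \sum_l P xi ord0 l * jac F xi i l.

Let C1on_h P i : C1fld P -> C1on (regular F) (h P i).
Proof.
move=> CP; have sF : smooth F by case: dF.
have oreg := open_regular sF.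
apply: (C1onM oreg).
  by apply: (C1onV oreg) => //; apply: C1on_subset (C1on_det sF).
apply: (C1on_sum oreg) => l _; apply: C1on_subset (C1onM openT (CP l) (C1on_jac i l sF)).
exact: subsetT.
Qed.

Let piola_h (P v : fld R d) i xi : cube_cl xi ->
  (forall eta, cube_cl eta -> v (F eta) = (\det (jac F eta))^-1 *: (P eta *m (jac F eta)^T)) ->
  cmp v i (F xi) = h P i xi.
Proof.
move=> cxi vE; rewrite /cmp vE// !mxE; congr (_ * _); apply: eq_bigr => l _.
by rewrite [in LHS]mxE.
Qed.

Lemma WN_pull1 N v i : WN N F v -> pull1 F (cmp v i).
Proof.
move=> [P /refW_C1 CP vE]; exists (h P i); first exact: C1on_h.
by move=> xi oxi; apply: piola_h => //; exact: cube_open_cl.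
Qed.

Lemma UN_pullv N v i : UN N F v -> pullv F (cmp v i).
Proof.
move=> [P /refU_div_free0[CP _ P0] vE]; exists (h P i); split; first exact: C1on_h.
  by move=> xi oxi; apply: piola_h => //; exact: cube_open_cl.
move=> xi cxi nxi; rewrite /h big1 ?mulr0// => l _.
by rewrite (P0 _ cxi nxi) mxE mul0r.
Qed.

Lemma UN_div0 N v x : UN N F v -> Omega F x -> div v x = 0.
Proof.
move=> [P /refU_div_free0[CP dP _] vE] [xi oxi <-].
exact: piola_div0 dF CP dP vE oxi.
Qed.

(** Serves the extrapolated velocity of the two-step scheme, which inherits zero divergence from the
    two previous velocities. *)
Lemma div_comb a b u v x : (forall i, pull1 F (cmp u i)) -> (forall i, pull1 F (cmp v i)) ->
  Omega F x -> div (fun x => a *: u x + b *: v x) x = a * div u x + b * div v x.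
Proof.
move=> pu pv Ox; rewrite /div !mulr_sumr -big_split; apply: eq_bigr => i _ /=.
rewrite (_ : cmp _ i = fun x => a * cmp u i x + b * cmp v i x); last first.
  by apply/funext => y; rewrite /cmp !mxE.
rewrite (pull1_pdD dF)//; last 2 first.
- exact/(pull1M dF)/pu/pull1_cst.
- exact/(pull1M dF)/pv/pull1_cst.
rewrite !(pull1_pdM dF)//; do ?exact: pull1_cst.
by rewrite !pd_cst !mulr0 !addr0.
Qed.

(** For divergence-free [w] the integrand is half the divergence of |v|^2 w, and this field vanishes
    on the boundary because [v] does. *)
Lemma convect_skew w v : (forall i, pull1 F (cmp w i)) ->
  (forall x, Omega F x -> div w x = 0) -> (forall i, pullv F (cmp v i)) ->
  ip (Omega F) (convect w v) v = 0.
Proof.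
move=> pw w0 vv; have pv i := pullv_pull1 (vv i).
(* One factor [v_i] is kept in front to carry the zero boundary values; the other factors need only
   be C^1 up to the boundary. *)
pose g i j x := cmp v i x * (cmp v i x * cmp w j x).
have vg i j : pullv F (g i j) by apply: (pullvM dF) => //; exact: (pull1M dF).
have p0 i j : pull0 F (fun x => 2^-1 * pd j (g i j) x).
  apply: pull0M; first exact: pull0_cst.
  exact: (pull1_pd dF _ (pullv_pull1 (vg i j))).
rewrite /ip (eq_volint d23 (g := fun x => \sum_i \sum_j 2^-1 * pd j (g i j) x)); last first.
  move=> x Ox; rewrite /dotv /convect.
  (* A multiple of the divergence of [w], which is zero, is added to complete the product rule for
     [g i j]. *)
  transitivity (\sum_i (2^-1 * (cmp v i x * cmp v i x) * div w x +
      (\sum_j cmp w j x * pd j (cmp v i) x) * cmp v i x)).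
    by apply: eq_bigr => i _; rewrite w0// mulr0 add0r mxE.
  apply: eq_bigr => i _; rewrite /div mulr_sumr mulr_suml -big_split; apply: eq_bigr => j _ /=.
  rewrite /g (pull1_pdM dF _ (pv i) (pull1M dF (pv i) (pw j)))// (pull1_pdM dF)//.
  by move: (cmp v i x) (cmp w j x) (pd j (cmp w j) x) (pd j (cmp v i) x) => a b c e; field.
rewrite (volint_sum d23 dF); last by move=> i; exact: pull0_sum.
rewrite big1// => i _; rewrite (volint_sum d23 dF)// big1// => j _.
rewrite (volintZ d23 dF); last exact: (pull1_pd dF _ (pullv_pull1 (vg i j))).
by rewrite (volint_pd d23 dF)// mulr0.
Qed.

Lemma pd_wedge (f g p q : 'rV[R]_d -> R) j x :
  pull1 F f -> pull1 F g -> pull1 F p -> pull1 F q -> Omega F x ->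
  pd j (fun x => f x * g x + (-1) * (p x * q x)) x =
  f x * pd j g x + g x * pd j f x - (p x * pd j q x + q x * pd j p x).
Proof.
move=> pf pg pp pq Ox.
have c1 := pull1_cst F (-1).
rewrite (pull1_pdD dF)//; [|exact: (pull1M dF)|by apply: (pull1M dF) => //; exact: (pull1M dF)].
rewrite (pull1_pdM dF _ c1 (pull1M dF pp pq))// !(pull1_pdM dF)// pd_cst.
by rewrite mulr0 addr0 mulN1r.
Qed.

Lemma pullv_wedge (f g p q : 'rV[R]_d -> R) :
  pullv F f -> pull1 F g -> pullv F p -> pull1 F q ->
  pullv F (fun x => f x * g x + (-1) * (p x * q x)).
Proof.
move=> vf pg vp pq; apply: (pullvD dF); first exact: (pullvM dF).
have H := pullvM dF (pullvM dF vp pq) (pull1_cst F (-1)).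
by apply: eq_pullv H => x; rewrite mulrC.
Qed.

Definition cpull0 v := forall i, pull0 F (cmp v i).

Lemma cpull0_comb a b u v : cpull0 u -> cpull0 v -> cpull0 (fun x => a *: u x + b *: v x).
Proof.
move=> pu pv i; apply: eq_pull0 (pull0D (pull0M (pull0_cst F a) (pu i))
  (pull0M (pull0_cst F b) (pv i))) => x _; by rewrite /cmp !mxE.
Qed.

Lemma pull0_dotv u v : cpull0 u -> cpull0 v -> pull0 F (fun x => dotv (u x) (v x)).
Proof. by move=> pu pv; apply: pull0_sum => i; exact: (pull0M (pu i) (pv i)). Qed.

(** Pointwise this is the polarisation of (v - u).v; the factor [1 *:] is the value of [gam] in the
    one-step scheme. *)
Lemma bdf1_energy u v : cpull0 u -> cpull0 v ->
  ip (Omega F) (fun x => 1 *: v x - u x) v =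
  2^-1 * sqn (Omega F) v - 2^-1 * sqn (Omega F) u + 2^-1 * sqn (Omega F) (fun x => v x - u x).
Proof.
move=> pu pv; rewrite /sqn /ip.
have pvu : cpull0 (fun x => v x - u x).
  by move=> i; apply: eq_pull0 (cpull0_comb 1 (-1) pv pu i) => x _; rewrite /cmp scale1r scaleN1r.
have Q a c : cpull0 a -> pull0 F (fun x => c * dotv (a x) (a x)).
  by move=> pa; apply: pull0M; [exact: pull0_cst | exact: pull0_dotv].
rewrite -mulNr -!(volintZ d23 dF); do ?exact: pull0_dotv.
rewrite -!(volintD d23 dF); do ?[exact: Q | apply: pull0D].
apply: (eq_volint d23) => x _; rewrite /dotv !mulr_sumr -!big_split /=.
by apply: eq_bigr => i _; rewrite !mxE; field.
Qed.

(** The G-stability identity of the two-step backward differentiation formula, with [t] the oldest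
    value: 2a(3a - 4b + c) = a^2 + (2a - b)^2 - b^2 - (2b - c)^2 + (a - 2b + c)^2, applied to each
    component. *)
Lemma bdf2_energy t u v : cpull0 t -> cpull0 u -> cpull0 v ->
  ip (Omega F) (fun x => (3 / 2) *: v x - (2 *: u x - (1 / 2) *: t x)) v =
  4^-1 * sqn (Omega F) v + 4^-1 * sqn (Omega F) (fun x => 2 *: v x - u x)
  - 4^-1 * sqn (Omega F) u - 4^-1 * sqn (Omega F) (fun x => 2 *: u x - t x)
  + 4^-1 * sqn (Omega F) (fun x => v x - 2 *: u x + t x).
Proof.
move=> pt pu pv; rewrite /sqn /ip.
have p2 a b : cpull0 a -> cpull0 b -> cpull0 (fun x => 2 *: a x - b x).
  by move=> pa pb i; apply: eq_pull0 (cpull0_comb 2 (-1) pa pb i) => x _; rewrite /cmp scaleN1r.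
have p3 : cpull0 (fun x => v x - 2 *: u x + t x).
  move=> i; apply: eq_pull0 (cpull0_comb 1 1 (cpull0_comb 1 (-2) pv pu) pt i) => x _.
  by rewrite /cmp !scale1r scaleNr.
have Q a c : cpull0 a -> pull0 F (fun x => c * dotv (a x) (a x)).
  by move=> pa; apply: pull0M; [exact: pull0_cst | exact: pull0_dotv].
have [p4 p5] := (p2 _ _ pv pu, p2 _ _ pu pt).
rewrite -!mulNr -!(volintZ d23 dF); do ?exact: pull0_dotv.
rewrite -!(volintD d23 dF); do ?[exact: Q | apply: pull0D].
apply: (eq_volint d23) => x _; rewrite /dotv !mulr_sumr -!big_split /=.
by apply: eq_bigr => i _; rewrite !mxE; field.
Qed.

End EnergyIdentities.

(** * Cancellation of the Lorentz and induction terms *)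

Section Coupling.
Variable R : realType.

(** With c = u x Bt, the Lorentz integrand is -c curl B, while the induction integrand is c curl B
    plus derivatives of the products c B_k. These products vanish on the boundary because c carries
    [u], so the derivatives integrate to zero. *)
Lemma lorentz_induct2 (F u B Bt : fld R 2) : diffeo_cube F ->
  (forall i, pullv F (cmp u i)) -> (forall i, pull1 F (cmp B i)) ->
  (forall i, pull1 F (cmp Bt i)) ->
  ip (Omega F) (lorentz2 B Bt) u + ip (Omega F) (induct2 u Bt) B = 0.
Proof.
move=> dF vu pB pBt; have d23 : (2 = 2 \/ 2 = 3)%N by left.
pose c x := cross2 (u x) (Bt x).
have vc : pullv F c.
  apply: eq_pullv (pullv_wedge dF (vu (i2 0)) (pBt (i2 1)) (vu (i2 1)) (pBt (i2 0))) => x.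
  by rewrite mulN1r.
have pc := pullv_pull1 vc; have pc0 := pull1_pull0 dF pc.
pose L x := - (curl2 B x * c x).
have pL : pull0 F L.
  apply: pull0N; apply: pull0M => //; apply: pull0D; last apply: pull0N; exact: (pull1_pd dF).
have EL : ip (Omega F) (lorentz2 B Bt) u = volint (Omega F) L.
  apply: (eq_volint d23) => x _; rewrite /dotv sum2E /lorentz2 /scross2 row2_0 row2_1.
  by rewrite /L /c /cross2; ring.
have vG k : pullv F (fun x => c x * cmp B k x) by exact: (pullvM dF).
have pG k j : pull0 F (pd j (fun x => c x * cmp B k x)) := pull1_pd dF j (pullv_pull1 (vG k)).
have pm f : pull0 F f -> pull0 F (fun x => (-1) * f x).
  by move=> pf; apply: pull0M => //; exact: pull0_cst.
have EI : ip (Omega F) (induct2 u Bt) B = volint (Omega F) (fun x =>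
    pd (i2 1) (fun x => c x * cmp B (i2 0) x) x +
    ((-1) * pd (i2 0) (fun x => c x * cmp B (i2 1) x) x + (-1) * L x)).
  apply: (eq_volint d23) => x Ox; rewrite /dotv sum2E /induct2 /scurl2 row2_0 row2_1.
  rewrite !(pull1_pdM dF _ pc)// /L /curl2 -/c.
  rewrite -[B x ord0 (i2 0)]/(cmp B (i2 0) x) -[B x ord0 (i2 1)]/(cmp B (i2 1) x).
  move: (cmp B (i2 0) x) (cmp B (i2 1) x) (c x) (pd _ c x) (pd _ c x) => *.
  by move: (pd _ _ x) (pd _ _ x) => *; ring.
rewrite EI EL (volintD d23 dF); [|exact: pG|by apply: pull0D; exact: pm].
rewrite (volintD d23 dF); [|exact: pm|exact: pm].
by rewrite !(volintZ d23 dF)// !(volint_pd d23 dF)//; ring.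
Qed.

Let triple_product (w0 w1 w2 b0 b1 b2 u0 u1 u2 : R) :
  (w1 * b2 - w2 * b1) * u0 + (w2 * b0 - w0 * b2) * u1 + (w0 * b1 - w1 * b0) * u2 =
  - (w0 * (u1 * b2 - u2 * b1) + w1 * (u2 * b0 - u0 * b2) + w2 * (u0 * b1 - u1 * b0)).
Proof. ring. Qed.

(** The scalar triple product turns the Lorentz integrand into -c . curl B with c = u x Bt, and
    div(c x B) = B . curl c - c . curl B moves the curl; c x B vanishes on the boundary through
    [u]. *)
Lemma lorentz_induct3 (F u B Bt : fld R 3) : diffeo_cube F ->
  (forall i, pullv F (cmp u i)) -> (forall i, pull1 F (cmp B i)) ->
  (forall i, pull1 F (cmp Bt i)) ->
  ip (Omega F) (lorentz3 B Bt) u + ip (Omega F) (induct3 u Bt) B = 0.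
Proof.
move=> dF vu pB pBt; have d23 : (3 = 2 \/ 3 = 3)%N by right.
pose c : fld R 3 := fun x => cross3 (u x) (Bt x).
have vc i : pullv F (cmp c i).
  case: (ord3P i) => ->.
  - apply: eq_pullv (pullv_wedge dF (vu (i3 1)) (pBt (i3 2)) (vu (i3 2)) (pBt (i3 1))) => x.
    by rewrite mulN1r; exact: esym (row3_0 _ _ _).
  - apply: eq_pullv (pullv_wedge dF (vu (i3 2)) (pBt (i3 0)) (vu (i3 0)) (pBt (i3 2))) => x.
    by rewrite mulN1r; exact: esym (row3_1 _ _ _).
  - apply: eq_pullv (pullv_wedge dF (vu (i3 0)) (pBt (i3 1)) (vu (i3 1)) (pBt (i3 0))) => x.
    by rewrite mulN1r; exact: esym (row3_2 _ _ _).
have pc i := pullv_pull1 (vc i); have pc0 i := pull1_pull0 dF (pc i).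
have p0d f j : pull1 F f -> pull0 F (pd j f) by exact: (pull1_pd dF).
pose L x := - dotv (curl3 B x) (c x).
have pL : pull0 F L.
  apply: pull0N; apply: pull0_dotv => // i.
  case: (ord3P i) => ->.
  - apply: (eq_pull0 (f := fun x => pd (i3 1) (cmp B (i3 2)) x - pd (i3 2) (cmp B (i3 1)) x)).
      by move=> x _; exact: esym (row3_0 _ _ _).
    by apply: pull0D; last apply: pull0N; exact: p0d.
  - apply: (eq_pull0 (f := fun x => pd (i3 2) (cmp B (i3 0)) x - pd (i3 0) (cmp B (i3 2)) x)).
      by move=> x _; exact: esym (row3_1 _ _ _).
    by apply: pull0D; last apply: pull0N; exact: p0d.
  - apply: (eq_pull0 (f := fun x => pd (i3 0) (cmp B (i3 1)) x - pd (i3 1) (cmp B (i3 0)) x)).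
      by move=> x _; exact: esym (row3_2 _ _ _).
    by apply: pull0D; last apply: pull0N; exact: p0d.
have EL : ip (Omega F) (lorentz3 B Bt) u = volint (Omega F) L.
  apply: (eq_volint d23) => x _; rewrite /L /dotv !sum3E /lorentz3 /c /cross3.
  rewrite !row3_0 !row3_1 !row3_2.
  exact: triple_product.
(* For cyclically ordered indices these are the components of the vector product of [c] and [B],
   whose divergence is summed below. *)
pose G i j x := cmp c i x * cmp B j x + (-1) * (cmp c j x * cmp B i x).
have vG i j : pullv F (G i j) by exact: (pullv_wedge dF).
have pG i j k : pull0 F (pd k (G i j)) := p0d _ k (pullv_pull1 (vG i j)).
have pmL : pull0 F (fun x => (-1) * L x) by apply: pull0M => //; exact: pull0_cst.
have EI : ip (Omega F) (induct3 u Bt) B = volint (Omega F) (fun x =>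
    pd (i3 0) (G (i3 1) (i3 2)) x + (pd (i3 1) (G (i3 2) (i3 0)) x +
    (pd (i3 2) (G (i3 0) (i3 1)) x + (-1) * L x))).
  rewrite (_ : induct3 u Bt = curl3 c)//; clearbody c.
  apply: (eq_volint d23) => x Ox; rewrite /L /dotv !sum3E /curl3.
  rewrite !row3_0 !row3_1 !row3_2 !(pd_wedge dF)//.
  rewrite -[B x ord0 (i3 0)]/(cmp B (i3 0) x) -[B x ord0 (i3 1)]/(cmp B (i3 1) x)
    -[B x ord0 (i3 2)]/(cmp B (i3 2) x).
  rewrite -[c x ord0 (i3 0)]/(cmp c (i3 0) x) -[c x ord0 (i3 1)]/(cmp c (i3 1) x)
    -[c x ord0 (i3 2)]/(cmp c (i3 2) x).
  move: (cmp B (i3 0) x) (cmp B (i3 1) x) (cmp B (i3 2) x) => b0 b1 b2.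
  move: (cmp c (i3 0) x) (cmp c (i3 1) x) (cmp c (i3 2) x) => c0 c1 c2.
  move: (pd (i3 0) (cmp B (i3 1)) x) (pd (i3 0) (cmp B (i3 2)) x)
    (pd (i3 1) (cmp B (i3 0)) x) (pd (i3 1) (cmp B (i3 2)) x)
    (pd (i3 2) (cmp B (i3 0)) x) (pd (i3 2) (cmp B (i3 1)) x) => *.
  move: (pd (i3 0) (cmp c (i3 1)) x) (pd (i3 0) (cmp c (i3 2)) x)
    (pd (i3 1) (cmp c (i3 0)) x) (pd (i3 1) (cmp c (i3 2)) x)
    (pd (i3 2) (cmp c (i3 0)) x) (pd (i3 2) (cmp c (i3 1)) x) => *.
  by ring.
rewrite EI EL; do 3 ?[rewrite (volintD d23 dF); [|exact: pG|by do ?[exact: pmL|exact: pG|apply: pull0D]]].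
by rewrite (volintZ d23 dF)// !(volint_pd d23 dF)//; ring.
Qed.

Lemma lorentz_induct (d : nat) (F u B Bt : fld R d) : (d = 2 \/ d = 3)%N -> diffeo_cube F ->
  (forall i, pullv F (cmp u i)) -> (forall i, pull1 F (cmp B i)) ->
  (forall i, pull1 F (cmp Bt i)) ->
  ip (Omega F) (lorentz B Bt) u + ip (Omega F) (induct u Bt) B = 0.
Proof.
move=> d23; move: F u B Bt; case: d23 => ->; [exact: lorentz_induct2|exact: lorentz_induct3].
Qed.

End Coupling.

(** * The discrete energy law *)

Theorem theorem3p1 (R : realType) (d N k n : nat) (F : 'rV[R]_d -> 'rV[R]_d)
  (nu eta mu rho tau : R) (u B f : nat -> 'rV[R]_d -> 'rV[R]_d) :
  (d = 2 \/ d = 3)%N -> (4 <= N)%N -> diffeo_cube F ->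
  0 < nu -> 0 < eta -> 0 < mu -> 0 < rho -> 0 < tau ->
  (k = 1 \/ k = 2)%N -> (k - 1 <= n)%N ->
  (forall j, (1 <= j <= k)%N -> UN N F (u (n.+1 - j)%N) /\ WN N F (B (n.+1 - j)%N)) ->
  UN N F (u n.+1) -> WN N F (B n.+1) ->
  (forall x, f n.+1 x = 0) ->
  (forall chi, UN N F chi ->
     tau^-1 * ip (Omega F) (fun x => gam k *: u n.+1 x - hatf k u n x) chi
     + ip (Omega F) (convect (tldf k u n) (u n.+1)) chi
     + nu * ipgrad (Omega F) (u n.+1) chi
     = (mu * rho)^-1 * ip (Omega F) (lorentz (B n.+1) (tldf k B n)) chi
       + ip (Omega F) (f n.+1) chi) ->
  (forall Phi, WN N F Phi ->
     tau^-1 * ip (Omega F) (fun x => gam k *: B n.+1 x - hatf k B n x) Phi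
     + eta * volint (Omega F) (curldot (B n.+1) Phi)
     - ip (Omega F) (induct (u n.+1) (tldf k B n)) Phi = 0) ->
  energy k (Omega F) mu rho tau u B n.+1 - energy k (Omega F) mu rho tau u B n
  = - dissip k (Omega F) mu rho tau u B n
    - nu * ipgrad (Omega F) (u n.+1) (u n.+1)
    - eta / (mu * rho) * volint (Omega F) (curldot (B n.+1) (B n.+1)).
Proof.
move=> d23 N4 dF nu0 eta0 mu0 rho0 tau0 k12 kn hist Un Wn f0 eqU eqB.
have pu1 v : UN N F v -> forall i, pull1 F (cmp v i).
  by move=> Uv i; exact/pullv_pull1/(UN_pullv dF i Uv).
have pu0 v : UN N F v -> cpull0 F v.
  by move=> Uv i; exact/(pull1_pull0 dF)/pu1.
have pB0 v : WN N F v -> cpull0 F v.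
  by move=> Wv i; exact/(pull1_pull0 dF)/(WN_pull1 dF i Wv).
(* The extrapolation is rewritten as a linear combination, the form covered by [div_comb] and by the
   closure properties of [pull1]. *)
have tE (c : nat -> fld R d) : k = 2%N ->
    tldf k c n = (fun x => 2 *: c n x + (-1) *: c n.-1 x).
  by move=> ->; apply/funext => x; rewrite /tldf /= scaleN1r.
have hist1 : UN N F (u n) /\ WN N F (B n).
  by have := hist 1%N; rewrite subn1; apply; case: k12 => ->.
have hist2 : k = 2%N -> UN N F (u n.-1) /\ WN N F (B n.-1).
  by move=> k2; have := hist 2%N; rewrite k2 subn2; exact.
have pulltld (c : nat -> fld R d) : (forall i, pull1 F (cmp (c n) i)) ->
    (k = 2%N -> forall i, pull1 F (cmp (c n.-1) i)) -> forall i, pull1 F (cmp (tldf k c n) i).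
  move=> p1 p2 i; case: k12 => k12; first by rewrite /tldf k12.
  have c2 := pull1_cst F (2 : R); have c1 := pull1_cst F (-1 : R).
  rewrite (tE _ k12); apply: eq_pull1 (pull1D dF (pull1M dF c2 (p1 i)) (pull1M dF c1 (p2 k12 i))) => x.
  by rewrite /cmp !mxE.
have ptu : forall i, pull1 F (cmp (tldf k u n) i).
  by apply: pulltld => [|k2]; apply: pu1; [exact: hist1.1|exact: (hist2 k2).1].
have ptB : forall i, pull1 F (cmp (tldf k B n) i).
  by apply: pulltld => [|k2] i; apply: (WN_pull1 (N := N) dF); [exact: hist1.2|exact: (hist2 k2).2].
have dtu x : Omega F x -> div (tldf k u n) x = 0.
  move=> Ox; case: k12 => k12; first by rewrite /tldf k12 /=; exact: (UN_div0 dF hist1.1).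
  rewrite (tE _ k12) (div_comb dF)//; [|exact/pu1/hist1.1|exact/pu1/(hist2 k12).1].
  by rewrite (UN_div0 dF hist1.1)// (UN_div0 dF (hist2 k12).1)// !mulr0 addr0.
have conv0 := convect_skew d23 dF ptu dtu (fun i => UN_pullv dF i Un).
have coup := lorentz_induct d23 dF (fun i => UN_pullv dF i Un) (fun i => WN_pull1 dF i Wn) ptB.
have ef : ip (Omega F) (f n.+1) (u n.+1) = 0.
  rewrite -[RHS](volint0 d23 dF); apply: (eq_volint d23) => x _.
  by rewrite /dotv big1// => i _; rewrite f0 mxE mul0r.
have := eqU _ Un; have := eqB _ Wn; rewrite conv0 ef.
move: coup.
set LI := ip _ (lorentz _ _) _; set II := ip _ (induct _ _) _.
set CC := volint _ _; set GG := ipgrad _ _ _.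
move=> coup EB EU.
have mr : mu * rho != 0 by rewrite mulf_neq0// gt_eqF.
have t0 : tau != 0 by rewrite gt_eqF.
have {coup} IL : II = - LI by apply/eqP; rewrite -addr_eq0 addrC coup.
(* Added with weights 1 and [(mu * rho)^-1], the tested equations lose their coupling terms. What
   remains is a statement about time differences alone, obtained from the one- or two-step identity
   for each field. *)
suff time : energy k (Omega F) mu rho tau u B n.+1 - energy k (Omega F) mu rho tau u B n
    + dissip k (Omega F) mu rho tau u B n =
  tau^-1 * ip (Omega F) (fun x => gam k *: u n.+1 x - hatf k u n x) (u n.+1) +
  (mu * rho)^-1 *
    (tau^-1 * ip (Omega F) (fun x => gam k *: B n.+1 x - hatf k B n x) (B n.+1)).
  move: EB EU time; rewrite IL; set TB := tau^-1 * _; set TU := tau^-1 * _.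
  move: (energy _ _ _ _ _ _ _ _) (energy _ _ _ _ _ _ _ _) (dissip _ _ _ _ _ _ _ _).
  move=> E0 E1 D EB EU time.
  have -> : E1 - E0 = TU + (mu * rho)^-1 * TB - D by rewrite -time addrK.
  have -> : TB = - LI - eta * CC by apply/eqP; rewrite -subr_eq0 -[X in _ == X]EB; apply/eqP; ring.
  have -> : TU = (mu * rho)^-1 * LI - nu * GG.
    by move: EU; rewrite !addr0 => <-; ring.
  by ring.
case: k12 => k12; rewrite k12 /energy /dissip /gam /hatf /=.
  rewrite (bdf1_energy d23 dF (pu0 _ hist1.1) (pu0 _ Un)) (bdf1_energy d23 dF (pB0 _ hist1.2) (pB0 _ Wn)).
  move: (sqn _ _) (sqn _ _) (sqn _ _) (sqn _ _) (sqn _ _) (sqn _ _) => *.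
  by field; rewrite t0 gt_eqF// gt_eqF.
rewrite (bdf2_energy d23 dF (pu0 _ (hist2 k12).1) (pu0 _ hist1.1) (pu0 _ Un)).
rewrite (bdf2_energy d23 dF (pB0 _ (hist2 k12).2) (pB0 _ hist1.2) (pB0 _ Wn)).
move: (sqn _ _) (sqn _ _) (sqn _ _) (sqn _ _) (sqn _ _) => a1 a2 a3 a4 a5.
move: (sqn _ _) (sqn _ _) (sqn _ _) (sqn _ _) (sqn _ _) => *.
by field; rewrite t0 gt_eqF// gt_eqF.
Qed.
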